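(* Let $p,n\geq 1$ be integers, let $0\leq\alpha<1$ and let $\beta,\gamma\geq 0$ be real numbers. Let $f\in\mathcal{A}_{p,n}$. (i) If \[\left|\frac{f'(z)}{pz^{p-1}}-1\right|^\beta\left|\frac{f''(z)}{z^{p-2}}-(p-1)\frac{f'(z)}{z^{p-1}}\right|^\gamma<\frac{(pn)^\gamma(1-\alpha)^{\beta+\gamma}}{2^{\beta+2\gamma}}\qquad\text{for all } z\in\mathbb{D},\] then \[\operatorname{Re}\left(\frac{f'(z)}{pz^{p-1}}\right)>\frac{1+\alpha}{2}\qquad\text{for all } z\in\mathbb{D}.\] (ii) If \[\left|\frac{f'(z)}{pz^{p-1}}-1\right|^\beta\left|\frac{f''(z)}{z^{p-2}}-(p-1)\frac{f'(z)}{z^{p-1}}\right|^\gamma<(pn)^\gamma|1-\alpha|^{\beta+\gamma}\qquad\text{for all } z\in\mathbb{D},\] then \[\left|\frac{f'(z)}{pz^{p-1}}-1\right|<1-\alpha\qquad\text{for all } z\in\mathbb{D}.\]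
   Context: $\mathbb{D}=\{z\in\mathbb{C}:|z|<1\}$ is the open unit disk. For positive integers $p,n$, $\mathcal{A}_{p,n}$ is the class of all analytic functions $f:\mathbb{D}\to\mathbb{C}$ whose power series at $0$ has the form $f(z)=z^{p}+a_{n+p}z^{n+p}+a_{n+p+1}z^{n+p+1}+\cdots$. Quotients by powers of $z$ are understood with removable singularities at $z=0$ removed: $f'(z)/(pz^{p-1})$ has value $1$ at $z=0$, and $f''(z)/z^{p-2}-(p-1)f'(z)/z^{p-1}$ is analytic on $\mathbb{D}$ with value $0$ at $z=0$ (for $p=1$, $f''(z)/z^{p-2}$ means $zf''(z)$). A power with exponent $0$ equals $1$. *)

(* Defs.v *)
From Stdlib Require Import Reals ZArith.
From Coquelicot Require Import Coquelicot.

Open Scope R_scope.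

Definition unit_disk (z : C) : Prop := Cmod z < 1.

Definition has_pseries_at (f : C -> C) (z0 : C) (a : nat -> C) : Prop :=
  exists r : R, 0 < r /\
    forall z : C, Cmod (z - z0)%C < r ->
      @is_pseries C_AbsRing C_NormedModule a (z - z0)%C (f z).

(* Functions on the disk are represented by total functions on C; only the
   values on the disk matter, as the disk is open. *)
Definition analytic_on_disk (f : C -> C) : Prop :=
  forall z0 : C, unit_disk z0 -> exists a : nat -> C, has_pseries_at f z0 a.

Definition class_A (p n : nat) (f : C -> C) : Prop :=
  analytic_on_disk f /\
  exists a : nat -> C,
    has_pseries_at f (RtoC 0) a /\
    a p = RtoC 1 /\
    forall k : nat, (k < n + p)%nat -> k <> p -> a k = RtoC 0.

Definition Cpowz (z : C) (m : Z) : C :=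
  match m with
  | Z0 => RtoC 1
  | Zpos k => Cpow z (Pos.to_nat k)
  | Zneg k => Cinv (Cpow z (Pos.to_nat k))
  end.

(* Real power of a base x >= 0, with 0 ^ 0 = 1 and 0 ^ y = 0 for y > 0.
   Rpower alone is not suitable: its value at base 0 is always 1. *)
Definition rpow0 (x y : R) : R :=
  if Req_EM_T y 0 then 1
  else if Req_EM_T x 0 then 0
  else Rpower x y.

(* f'(z) / (p z^(p-1)), with its removable singularity at 0 removed when f is
   in class_A p n with p, n >= 1; the subtraction on nat is exact for p >= 1. *)
Definition deriv_quot (p : nat) (f : C -> C) (z : C) : C :=
  if Ceq_dec z (RtoC 0) then RtoC 1
  else (C_derive f z / (RtoC (INR p) * Cpow z (p - 1)))%C.

(* f''(z) / z^(p-2) - (p-1) f'(z) / z^(p-1), likewise; for p = 1 the exponent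
   p - 2 is negative, hence the integer power. *)
Definition deriv2_quot (p : nat) (f : C -> C) (z : C) : C :=
  if Ceq_dec z (RtoC 0) then RtoC 0
  else (C_derive (C_derive f) z / Cpowz z (Z.of_nat p - 2)
        - (RtoC (INR p) - RtoC 1) * (C_derive f z / Cpow z (p - 1)))%C.

(* Main.v *)
Require Import Defs.
From Stdlib Require Import Reals ZArith.
From Coquelicot Require Import Coquelicot.
From Stdlib Require Import Lra Lia Classical ClassicalEpsilon.
Open Scope R_scope.

(** Put q(z) = f'(z) / (p z^(p-1)) = 1 + z^n H(z); then the second quantity of the hypothesis is p z q'(z).
    If the conclusion fails, take a point z0 of least modulus where it does, and let w = (q - 1) / (1 - alpha)
    in (ii), w = (1 - q) / (q - alpha) in (i), so that |w| < 1 for |z| < |z0| and |w(z0)| = 1.  Since w vanishes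
    to order n at 0, Schwarz' lemma gives |w(z)| <= (|z| / |z0|)^n, and comparing both sides along the radius
    through z0 yields |z0 w'(z0)| >= n (a form of Jack's lemma).  Expressed through q, this contradicts the
    hypothesis at z0.

    The maximum principle behind Schwarz' lemma only uses second-order Taylor expansions at each point, a property
    that, unlike local power series expansions, is easily seen to be stable under quotients. *)

(** * Complex power series *)

(** In (i), Re q > (1 + alpha) / 2 says that q is closer to 1 than to alpha; this amounts to |w| < 1
    and keeps q - alpha away from 0. At z0 one has |q - 1| = |q - alpha| = rho >= (1 - alpha) / 2,
    and w' = - (1 - alpha) q' / (q - alpha)^2 turns |z0 w'(z0)| >= n into |z0 q'(z0)| >= n rho^2 /
    (1 - alpha) >= n (1 - alpha) / 4. The factors 1/2 and 1/4 account for the 2^(beta + 2 gamma) of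
    the hypothesis. In (ii), |q - 1| = 1 - alpha and |z0 q'(z0)| >= n (1 - alpha) at z0.

    The obstacle is that analyticity supplies a power series around each point with no control of
    its radius, so no single expansion of q on the disk is at hand. H is therefore pieced together
    from its value at 0 and the quotient (q - 1) / z^n elsewhere; the series at 0 serves only to
    expand H there. *)

Notation C_series := (@is_series C_AbsRing C_NormedModule).

Lemma is_pseries_C (a : nat -> C) (u l : C) :
  @is_pseries C_AbsRing C_NormedModule a u l
  <-> C_series (fun k => a k * u ^ k)%C l.
Proof.
  assert (E : forall k, scal (pow_n (K := C_Ring) u k) (a k) = (a k * u ^ k)%C).
  { intro k.
    assert (P : pow_n (K := C_Ring) u k = Cpow u k).
    { induction k as [|k IH]; [reflexivity|]. simpl. now rewrite IH. }
    rewrite P. apply Cmult_comm. }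
  split; intro H.
  - eapply is_series_ext; [|exact H]. exact E.
  - eapply is_series_ext; [|exact H]. intro k. symmetry. apply E.
Qed.

Lemma C_norm (x : C) : norm (V := C_NormedModule) x = Cmod x.
Proof. reflexivity. Qed.

Lemma C_series_norm_le (a : nat -> C) (b : nat -> R) (l : C) (L : R) :
  C_series a l -> is_series b L -> (forall k, Cmod (a k) <= b k) -> Cmod l <= L.
Proof.
  intros Ha Hb Hab.
  assert (H1 : is_lim_seq (fun N => Cmod (sum_n (G := C_NormedModule) a N)) (Cmod l)).
  { eapply filterlim_comp; [exact Ha|]. apply (filterlim_norm (V := C_NormedModule)). }
  refine (is_lim_seq_le _ _ (Finite (Cmod l)) (Finite L) _ H1 Hb).
  intro N. rewrite <- C_norm. unfold sum_n.
  eapply Rle_trans; [apply (norm_sum_n_m (V := C_NormedModule))|].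
  apply sum_n_m_le. intro k. rewrite C_norm. apply Hab.
Qed.

(** A term is the difference of two consecutive partial sums, and these are bounded because they
    converge. *)
Lemma C_series_bounded (a : nat -> C) (l : C) :
  C_series a l -> exists M, forall k, Cmod (a k) <= M.
Proof.
  intro Ha.
  destruct (filterlim_bounded (V := C_NormedModule) _ (ex_intro _ l Ha)) as [M HM].
  exists (M + M). intros [|k].
  - specialize (HM 0%nat). rewrite sum_O, C_norm in HM.
    pose proof (Cmod_ge_0 (a 0%nat)). lra.
  - pose proof (HM k) as H1. pose proof (HM (S k)) as H2.
    rewrite sum_Sn in H2. rewrite C_norm in H1, H2.
    set (s := sum_n (G := C_NormedModule) a k) in *.
    replace (a (S k)) with (plus (G := C_NormedModule) s (a (S k)) + (- s))%C
      by (change (plus (G := C_NormedModule) s (a (S k))) with (s + a (S k))%C; ring).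
    eapply Rle_trans; [apply Cmod_triangle|]. rewrite Cmod_opp. lra.
Qed.

(** A Cauchy-type estimate without integrals: the series converges at the real point [r / 2], so its
    terms there are bounded. *)
Lemma pseries_coef_bound (f : C -> C) (z0 : C) (a : nat -> C) :
  has_pseries_at f z0 a ->
  exists rho M, 0 < rho /\ 0 <= M
    /\ (forall k, Cmod (a k) <= M * (/ rho) ^ k)
    /\ forall u, Cmod u <= rho -> C_series (fun k => a k * u ^ k)%C (f (z0 + u)%C).
Proof.
  intros [r [Hr Hf]].
  assert (H : forall u, Cmod u <= r / 2 ->
            C_series (fun k => a k * u ^ k)%C (f (z0 + u)%C)).
  { intros u Hu. apply (proj1 (is_pseries_C a u (f (z0 + u)%C))).
    assert (E : (z0 + u - z0)%C = u) by ring.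
    specialize (Hf (z0 + u)%C). rewrite E in Hf. apply Hf. lra. }
  assert (Hrho : Cmod (RtoC (r / 2)) = r / 2) by (rewrite Cmod_R; apply Rabs_pos_eq; lra).
  destruct (C_series_bounded _ _ (H (RtoC (r / 2)) (Req_le _ _ Hrho))) as [M HM].
  exists (r / 2), M. split; [lra|]. split; [|split; [|exact H]].
  - eapply Rle_trans; [apply Cmod_ge_0|apply (HM 0%nat)].
  - intro k. specialize (HM k).
    rewrite Cmod_mult, Cmod_pow, Hrho in HM.
    assert (P : 0 < (r / 2) ^ k) by (apply pow_lt; lra).
    rewrite pow_inv. apply (Rmult_le_reg_r ((r / 2) ^ k)); [exact P|].
    rewrite Rmult_assoc, Rinv_l, Rmult_1_r by lra. exact HM.
Qed.

Lemma C_series_eq (a b : nat -> C) (l l' : C) :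
  (forall k, a k = b k) -> l = l' -> C_series a l -> C_series b l'.
Proof. intros E <- H. eapply is_series_ext; [exact E|exact H]. Qed.

Lemma is_series_geom_half (c : R) : is_series (fun k => c * (/ 2) ^ k) (2 * c).
Proof.
  replace (2 * c) with (c * / (1 - / 2)) by field.
  apply (is_series_scal (K := R_AbsRing) (V := R_NormedModule) c), is_series_geom.
  rewrite Rabs_pos_eq; lra.
Qed.

(** For |u| < rho / 2 the tail after index N is dominated by a geometric series of ratio 1/2, whose
    sum gives the factor 2 in K. *)
Lemma pseries_taylor (g : C -> C) (z0 : C) (b : nat -> C) (N : nat) :
  has_pseries_at g z0 b ->
  exists K d, 0 < d /\ forall u, Cmod u < d ->
    Cmod (g (z0 + u)%C - sum_n (G := C_NormedModule) (fun k => b k * u ^ k)%C N)%C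
    <= K * Cmod u ^ S N.
Proof.
  intro Hg. destruct (pseries_coef_bound _ _ _ Hg) as [rho [M [Hrho [HM [Hb Hs]]]]].
  exists (M * (/ rho) ^ S N * 2), (rho / 2). split; [lra|]. intros u Hu.
  pose proof (Cmod_ge_0 u) as Hu0.
  replace (M * (/ rho) ^ S N * 2 * Cmod u ^ S N)
    with (2 * (M * (/ rho) ^ S N * Cmod u ^ S N)) by ring.
  eapply C_series_norm_le; [|apply is_series_geom_half|].
  - apply (is_series_incr_n (K := C_AbsRing) (V := C_NormedModule) (fun k => b k * u ^ k)%C (S N)); [lia|].
    simpl pred.
    eapply C_series_eq; [reflexivity| |apply Hs; lra].
    set (s := sum_n _ _).
    change (plus (G := C_NormedModule) (g (z0 + u)%C - s)%C s) with (g (z0 + u) - s + s)%C. ring.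
  - intro k. cbv beta. rewrite Cmod_mult, Cmod_pow, !pow_add.
    change (Cmod (b (S N + k)%nat) * (Cmod u ^ S N * Cmod u ^ k)
            <= M * (/ rho) ^ S N * Cmod u ^ S N * (/ 2) ^ k).
    assert (P1 : 0 <= Cmod u ^ S N) by now apply pow_le.
    assert (P2 : 0 <= (/ rho) ^ S N) by (apply pow_le, Rlt_le, Rinv_0_lt_compat, Hrho).
    assert (P3 : 0 <= Cmod u ^ k) by now apply pow_le.
    apply Rle_trans with (M * (/ rho) ^ (S N + k) * (Cmod u ^ S N * Cmod u ^ k)).
    { apply Rmult_le_compat_r; [apply Rmult_le_pos; assumption|apply Hb]. }
    rewrite pow_add.
    replace (M * ((/ rho) ^ S N * (/ rho) ^ k) * (Cmod u ^ S N * Cmod u ^ k))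
      with (M * (/ rho) ^ S N * Cmod u ^ S N * (Cmod u / rho) ^ k)
      by (unfold Rdiv; rewrite Rpow_mult_distr; ring).
    apply Rmult_le_compat_l; [apply Rmult_le_pos; [apply Rmult_le_pos|]; assumption|].
    apply pow_incr. split.
    + apply Rmult_le_pos; [assumption|apply Rlt_le, Rinv_0_lt_compat, Hrho].
    + apply (Rmult_le_reg_r rho); [assumption|].
      unfold Rdiv. rewrite Rmult_assoc, Rinv_l by lra. lra.
Qed.

(** * Termwise differentiation of power series *)

Lemma C_derive_quadratic (f : C -> C) (z l : C) (K d : R) :
  0 < d ->
  (forall v, Cmod v < d -> Cmod (f (z + v) - f z - l * v)%C <= K * Cmod v ^ 2) ->
  C_derive f z = l.
Proof.
  intros Hd H. unfold C_derive. apply is_C_lim_unique.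
  apply filterlim_locally. intro eps.
  set (K' := Rabs K + 1).
  assert (HK : 0 < K') by (pose proof (Rabs_pos K); unfold K'; lra).
  assert (He : 0 < Rmin d (eps / K')).
  { apply Rmin_pos; [exact Hd|]. apply Rdiv_lt_0_compat; [apply cond_pos|exact HK]. }
  (* Balls of [C_UniformSpace] are componentwise: radius e only bounds [Cmod] by sqrt 2 times e. *)
  assert (Hs : 0 < Rmin d (eps / K') / sqrt 2) by (apply Rdiv_lt_0_compat; [exact He|apply Rlt_sqrt2_0]).
  exists (mkposreal _ Hs).
  change (forall y : C, ball (M := C_UniformSpace) z (Rmin d (eps / K') / sqrt 2) y -> y <> z ->
            ball (M := C_UniformSpace) l eps ((f y - f z) / (y - z))%C).
  intros y Hy Hyz.
  apply (C_NormedModule_mixin_compat2 z y (mkposreal _ Hs)) in Hy. simpl in Hy.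
  change (minus y z) with (y - z)%C in Hy.
  replace (sqrt 2 * (Rmin d (eps / K') / sqrt 2)) with (Rmin d (eps / K')) in Hy
    by (field; apply Rgt_not_eq, Rlt_sqrt2_0).
  apply C_NormedModule_mixin_compat1.
  assert (Hne : (y - z)%C <> 0).
  { intro E. apply Hyz. replace y with (y - z + z)%C by ring. rewrite E. apply Cplus_0_l. }
  assert (Hp : 0 < Cmod (y - z)%C) by now apply Cmod_gt_0.
  change (Cmod ((f y - f z) / (y - z) - l)%C < eps).
  replace ((f y - f z) / (y - z) - l)%C with ((f y - f z - l * (y - z)) / (y - z))%C by now field.
  rewrite Cmod_div by assumption.
  assert (Hv : Cmod (f y - f z - l * (y - z))%C <= K * Cmod (y - z)%C ^ 2).
  { specialize (H (y - z)%C). replace (z + (y - z))%C with y in H by ring. apply H.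
    eapply Rlt_le_trans; [exact Hy|apply Rmin_l]. }
  apply (Rmult_lt_reg_r (Cmod (y - z)%C)); [exact Hp|].
  unfold Rdiv. rewrite Rmult_assoc, Rinv_l, Rmult_1_r by lra.
  apply Rle_lt_trans with (K' * Cmod (y - z)%C ^ 2).
  { eapply Rle_trans; [exact Hv|]. apply Rmult_le_compat_r; [apply pow2_ge_0|].
    pose proof (Rle_abs K). unfold K'; lra. }
  assert (Hy2 : Cmod (y - z)%C < eps / K') by (eapply Rlt_le_trans; [exact Hy|apply Rmin_r]).
  apply (Rmult_lt_compat_l K') in Hy2; [|exact HK].
  replace (K' * (eps / K')) with (pos eps) in Hy2 by (field; lra).
  nra.
Qed.

(* Induction: D_(k+1) = (u + v) D_k + k u^(k-1) v^2 for the left-hand side D_k. *)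
Lemma pow_linearization (u v : C) (s : R) (k : nat) :
  Cmod u <= s -> Cmod (u + v)%C <= s ->
  Cmod ((u + v) ^ k - u ^ k - RtoC (INR k) * u ^ pred k * v)%C * s ^ 2
  <= INR k ^ 2 * s ^ k * Cmod v ^ 2.
Proof.
  intros Hu Huv. assert (Hs : 0 <= s) by (eapply Rle_trans; [apply Cmod_ge_0|exact Hu]).
  induction k as [|k IH].
  { simpl. replace (1 - 1 - 0 * 1 * v)%C with (RtoC 0) by ring. rewrite Cmod_0. lra. }
  replace ((u + v) ^ S k - u ^ S k - RtoC (INR (S k)) * u ^ pred (S k) * v)%C
    with ((u + v) * ((u + v) ^ k - u ^ k - RtoC (INR k) * u ^ pred k * v)
          + RtoC (INR k) * u ^ pred k * v ^ 2)%C.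
  2:{ rewrite S_INR, RtoC_plus, !Cpow_S. simpl pred.
      destruct k as [|k]; [simpl; ring|]. simpl pred. rewrite Cpow_S. simpl. ring. }
  set (D := ((u + v) ^ k - u ^ k - RtoC (INR k) * u ^ pred k * v)%C) in *.
  apply Rle_trans with ((s * Cmod D + INR k * Cmod u ^ pred k * Cmod v ^ 2) * s ^ 2).
  { apply Rmult_le_compat_r; [apply pow2_ge_0|].
    eapply Rle_trans; [apply Cmod_triangle|].
    rewrite !Cmod_mult, !Cmod_pow, Cmod_R, (Rabs_pos_eq (INR k)) by apply pos_INR.
    apply Rplus_le_compat_r, Rmult_le_compat_r; [apply Cmod_ge_0|exact Huv]. }
  assert (Hk : INR k * Cmod u ^ pred k * s ^ 2 <= INR k * s ^ S k).
  { destruct k as [|k]; [simpl; lra|]. simpl pred. rewrite Rmult_assoc.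
    apply Rmult_le_compat_l; [apply pos_INR|].
    apply Rle_trans with (s ^ k * s ^ 2); [|simpl; lra].
    apply Rmult_le_compat_r; [apply pow2_ge_0|]. apply pow_incr. split; [apply Cmod_ge_0|exact Hu]. }
  rewrite S_INR. pose proof (pos_INR k) as P. pose proof (pow2_ge_0 (Cmod v)) as Pv.
  assert (P2 : 0 <= s ^ S k) by now apply pow_le.
  assert (A1 : s * (Cmod D * s ^ 2) <= INR k ^ 2 * s ^ S k * Cmod v ^ 2).
  { replace (INR k ^ 2 * s ^ S k * Cmod v ^ 2) with (s * (INR k ^ 2 * s ^ k * Cmod v ^ 2)) by (simpl; ring).
    now apply Rmult_le_compat_l. }
  apply (Rmult_le_compat_r (Cmod v ^ 2)) in Hk; [|exact Pv].
  assert (P3 : 0 <= s ^ S k * Cmod v ^ 2) by now apply Rmult_le_pos.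
  nra.
Qed.

Lemma S_INR_le_pow2 (k : nat) : INR (S k) <= 2 ^ k.
Proof.
  induction k as [|k IH]; [simpl; lra|].
  rewrite !S_INR in *. pose proof (pos_INR k). simpl pow. lra.
Qed.

(** The inductive step rests on (k + 1)^2 <= 2 k^2, true from k = 3 on; the values up to 3 are
    checked directly. *)
Lemma INR_sqr_le_pow2 (k : nat) : INR k ^ 2 <= 2 * 2 ^ k.
Proof.
  induction k as [|[|[|[|k]]] IH]; [simpl; lra | simpl; lra | simpl; lra | simpl; lra |].
  revert IH. rewrite !S_INR. pose proof (pos_INR k). simpl pow. nra.
Qed.

(** The remainder of f after its linear part is the series of the remainders of the monomials.
    [pow_linearization] bounds each of these by k^2 |v|^2 times a geometric term, so the sum is
    O(|v|^2) and [C_derive_quadratic] applies. *)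
Lemma has_pseries_derive (f : C -> C) (z0 : C) (a : nat -> C) :
  has_pseries_at f z0 a ->
  has_pseries_at (C_derive f) z0 (fun k => RtoC (INR (S k)) * a (S k))%C.
Proof.
  intro Hf. destruct (pseries_coef_bound _ _ _ Hf) as [rho [M [Hrho [HM [Hb Hs]]]]].
  (* With s / rho = 1/4 = (1/2)(1/2), one factor 2^(-k) absorbs the polynomial in k and the other
     one is summed. *)
  set (s := rho / 4). assert (Hs0 : 0 < s) by (unfold s; lra).
  assert (Hsr : s * / rho = / 4) by (unfold s; field; lra).
  assert (Hir : 0 < / rho) by now apply Rinv_0_lt_compat.
  assert (H42 : forall k, (/ 4) ^ k = (/ 2) ^ k * (/ 2) ^ k).
  { intro k. rewrite <- Rpow_mult_distr. f_equal. lra. }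
  assert (H22 : forall k, 2 ^ k * (/ 2) ^ k = 1).
  { intro k. rewrite <- Rpow_mult_distr. replace (2 * / 2) with 1 by lra. apply pow1. }
  assert (H2p : forall k, 0 < (/ 2) ^ k) by (intro; apply pow_lt; lra).
  exists s. split; [exact Hs0|]. intros z Hz.
  set (u := (z - z0)%C) in *. replace z with (z0 + u)%C by (unfold u; ring).
  assert (Hex : exists l : C, C_series (fun k => RtoC (INR (S k)) * a (S k) * u ^ k)%C l).
  { change (ex_series (V := C_CompleteNormedModule)
              (fun k => RtoC (INR (S k)) * a (S k) * u ^ k)%C).
    apply (ex_series_le (V := C_CompleteNormedModule)) with (b := fun k => (M * / rho) * (/ 2) ^ k).
    - intro k. change (norm (V := C_NormedModule) (RtoC (INR (S k)) * a (S k) * u ^ k)%C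
                       <= M * / rho * (/ 2) ^ k).
      rewrite C_norm, !Cmod_mult, Cmod_pow, Cmod_R, Rabs_pos_eq by apply pos_INR.
      apply Rle_trans with (2 ^ k * (M * (/ rho) ^ S k) * s ^ k).
      + apply Rmult_le_compat.
        * apply Rmult_le_pos; [apply pos_INR|apply Cmod_ge_0].
        * apply pow_le, Cmod_ge_0.
        * apply Rmult_le_compat; [apply pos_INR|apply Cmod_ge_0|apply S_INR_le_pow2|apply Hb].
        * apply pow_incr. split; [apply Cmod_ge_0|lra].
      + apply Req_le.
        replace (2 ^ k * (M * (/ rho) ^ S k) * s ^ k)
          with (M * / rho * 2 ^ k * (s * / rho) ^ k) by (rewrite Rpow_mult_distr; simpl; ring).
        rewrite Hsr, H42.
        replace (M * / rho * 2 ^ k * ((/ 2) ^ k * (/ 2) ^ k))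
          with (M * / rho * (2 ^ k * (/ 2) ^ k) * (/ 2) ^ k) by ring.
        rewrite H22. ring.
    - eexists. apply is_series_geom_half. }
  destruct Hex as [l Hl].
  (* The zero term k = 0 is put back, to align the derived series with that of f term by term. *)
  assert (Hl0 : C_series (fun k => RtoC (INR k) * a k * u ^ pred k)%C l).
  { apply is_series_decr_1.
    eapply C_series_eq; [reflexivity| |exact Hl].
    change (l = l + - (RtoC (INR 0) * a 0%nat * u ^ pred 0))%C. simpl. ring. }
  assert (E : C_derive f (z0 + u)%C = l).
  { apply C_derive_quadratic with (K := M * / s ^ 2 * 4) (d := s - Cmod u); [lra|].
    intros v Hv.
    assert (Huv : Cmod (u + v)%C <= s) by (eapply Rle_trans; [apply Cmod_triangle|lra]).
    pose proof (Hs (u + v)%C ltac:(unfold s in *; lra)) as S1.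
    pose proof (Hs u ltac:(unfold s in *; lra)) as S2.
    pose proof (is_series_scal (K := C_AbsRing) (V := C_NormedModule) v _ _ Hl0) as S3.
    pose proof (is_series_minus _ _ _ _ (is_series_minus _ _ _ _ S1 S2) S3) as S4.
    replace (z0 + (u + v))%C with (z0 + u + v)%C in S4 by ring.
    replace (M * / s ^ 2 * 4 * Cmod v ^ 2) with (2 * (2 * M * / s ^ 2 * Cmod v ^ 2)) by ring.
    eapply C_series_norm_le.
    - eapply C_series_eq; [intro; reflexivity| |exact S4].
      change (f (z0 + u + v) + - f (z0 + u) + - (v * l)
              = f (z0 + u + v) - f (z0 + u) - l * v)%C. ring.
    - apply is_series_geom_half.
    - intro k. 
      change (Cmod (a k * (u + v) ^ k + - (a k * u ^ k) + - (v * (RtoC (INR k) * a k * u ^ pred k)))%C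
              <= 2 * M * / s ^ 2 * Cmod v ^ 2 * (/ 2) ^ k).
      replace (a k * (u + v) ^ k + - (a k * u ^ k) + - (v * (RtoC (INR k) * a k * u ^ pred k)))%C
        with (a k * ((u + v) ^ k - u ^ k - RtoC (INR k) * u ^ pred k * v))%C by ring.
      rewrite Cmod_mult.
      pose proof (pow_linearization u v s k ltac:(lra) Huv) as HD.
      set (D := Cmod ((u + v) ^ k - u ^ k - RtoC (INR k) * u ^ pred k * v)%C) in *.
      assert (Ps : 0 < s ^ 2) by (apply pow_lt; lra).
      apply (Rmult_le_reg_r (s ^ 2)); [exact Ps|].
      replace (2 * M * / s ^ 2 * Cmod v ^ 2 * (/ 2) ^ k * s ^ 2)
        with (2 * M * Cmod v ^ 2 * (/ 2) ^ k) by (field; lra).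
      rewrite Rmult_assoc.
      assert (PD : 0 <= D * s ^ 2) by (apply Rmult_le_pos; [apply Cmod_ge_0|lra]).
      apply Rle_trans with (M * (/ rho) ^ k * ((2 * 2 ^ k) * s ^ k * Cmod v ^ 2)).
      + apply Rmult_le_compat; [apply Cmod_ge_0|exact PD|apply Hb|].
        eapply Rle_trans; [exact HD|].
        apply Rmult_le_compat_r; [apply pow2_ge_0|].
        apply Rmult_le_compat_r; [apply pow_le; lra|]. apply INR_sqr_le_pow2.
      + apply Req_le.
        replace (M * (/ rho) ^ k * (2 * 2 ^ k * s ^ k * Cmod v ^ 2))
          with (2 * M * Cmod v ^ 2 * (2 ^ k * (s * / rho) ^ k)) by (rewrite Rpow_mult_distr; ring).
        rewrite Hsr, H42, <- (Rmult_assoc (2 ^ k)), H22. ring. }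
  rewrite E. apply is_pseries_C. exact Hl.
Qed.

(** * Second-order Taylor expansions *)

(** The complex 2-jet of h at z, with cubic error. Order two is what the averaging argument of the
    maximum principle uses; explicit coefficients let the derivative be read off after products and
    quotients. *)
Definition taylor2 (h : C -> C) (z c0 c1 c2 : C) : Prop :=
  exists K d, 0 < d /\ forall u, Cmod u < d ->
    Cmod (h (z + u) - (c0 + c1 * u + c2 * u ^ 2))%C <= K * Cmod u ^ 3.

(** With K >= 0 and |u| < 1, higher powers of |u| can be absorbed into lower ones. *)
Lemma taylor2_normalize (h : C -> C) (z c0 c1 c2 : C) :
  taylor2 h z c0 c1 c2 ->
  exists K d, 0 <= K /\ 0 < d <= 1 /\ forall u, Cmod u < d ->
    Cmod (h (z + u) - (c0 + c1 * u + c2 * u ^ 2))%C <= K * Cmod u ^ 3.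
Proof.
  intros [K [d [Hd H]]]. exists (Rabs K), (Rmin d 1).
  split; [apply Rabs_pos|]. split; [split; [apply Rmin_pos; lra|apply Rmin_r]|].
  intros u Hu. eapply Rle_trans.
  - apply H. eapply Rlt_le_trans; [exact Hu|apply Rmin_l].
  - apply Rmult_le_compat_r; [apply pow_le, Cmod_ge_0|apply Rle_abs].
Qed.

Lemma taylor2_value (h : C -> C) (z c0 c1 c2 : C) : taylor2 h z c0 c1 c2 -> h z = c0.
Proof.
  intros [K [d [Hd H]]]. specialize (H 0%R). rewrite Cmod_0 in H. specialize (H Hd).
  replace (K * 0 ^ 3) with 0 in H by ring.
  replace (z + 0)%C with z in H by ring.
  replace (h z - (c0 + c1 * 0 + c2 * 0 ^ 2))%C with (h z - c0)%C in H by ring.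
  assert (E : (h z - c0)%C = 0).
  { apply Cmod_eq_0. apply Rle_antisym; [exact H|apply Cmod_ge_0]. }
  replace (h z) with (h z - c0 + c0)%C by ring. rewrite E. ring.
Qed.

Lemma taylor2_ext_loc (h g : C -> C) (z c0 c1 c2 : C) (d : R) :
  0 < d -> (forall u, Cmod u < d -> h (z + u)%C = g (z + u)%C) ->
  taylor2 h z c0 c1 c2 -> taylor2 g z c0 c1 c2.
Proof.
  intros Hd E [K [d' [Hd' H]]]. exists K, (Rmin d d').
  split; [now apply Rmin_pos|]. intros u Hu.
  rewrite <- E by (eapply Rlt_le_trans; [exact Hu|apply Rmin_l]).
  apply H. eapply Rlt_le_trans; [exact Hu|apply Rmin_r].
Qed.

Lemma taylor2_const (c z : C) : taylor2 (fun _ => c) z c 0 0.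
Proof.
  exists 0, 1. split; [lra|]. intros u _.
  replace (c - (c + 0 * u + 0 * u ^ 2))%C with (RtoC 0) by ring. rewrite Cmod_0. lra.
Qed.

Lemma taylor2_id (z : C) : taylor2 (fun x => x) z z 1 0.
Proof.
  exists 0, 1. split; [lra|]. intros u _.
  replace (z + u - (z + 1 * u + 0 * u ^ 2))%C with (RtoC 0) by ring. rewrite Cmod_0. lra.
Qed.

Lemma taylor2_plus (h g : C -> C) (z a0 a1 a2 b0 b1 b2 : C) :
  taylor2 h z a0 a1 a2 -> taylor2 g z b0 b1 b2 ->
  taylor2 (fun x => h x + g x)%C z (a0 + b0) (a1 + b1) (a2 + b2).
Proof.
  intros [K [d [Hd H]]] [K' [d' [Hd' H']]].
  exists (K + K'), (Rmin d d'). split; [now apply Rmin_pos|]. intros u Hu.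
  specialize (H u (Rlt_le_trans _ _ _ Hu (Rmin_l _ _))).
  specialize (H' u (Rlt_le_trans _ _ _ Hu (Rmin_r _ _))).
  replace (h (z + u) + g (z + u) - (a0 + b0 + (a1 + b1) * u + (a2 + b2) * u ^ 2))%C
    with ((h (z + u) - (a0 + a1 * u + a2 * u ^ 2)) + (g (z + u) - (b0 + b1 * u + b2 * u ^ 2)))%C by ring.
  eapply Rle_trans; [apply Cmod_triangle|]. lra.
Qed.

Lemma Cmod_poly2_le (c0 c1 c2 u : C) :
  Cmod u <= 1 -> Cmod (c0 + c1 * u + c2 * u ^ 2)%C <= Cmod c0 + Cmod c1 + Cmod c2.
Proof.
  intro Hu. pose proof (Cmod_ge_0 u) as P.
  eapply Rle_trans; [apply Cmod_triangle|]. apply Rplus_le_compat.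
  - eapply Rle_trans; [apply Cmod_triangle|]. apply Rplus_le_compat_l.
    rewrite Cmod_mult. pose proof (Cmod_ge_0 c1). nra.
  - rewrite Cmod_mult, Cmod_pow. pose proof (Cmod_ge_0 c2).
    assert (Cmod u ^ 2 <= 1) by nra. nra.
Qed.

(** Write h = P + e and g = Q + e' with quadratic P, Q. The error consists of the u^3 and u^4 terms
    of PQ, together with P e', e Q and e e', each O(|u|^3). *)
Lemma taylor2_mult (h g : C -> C) (z a0 a1 a2 b0 b1 b2 : C) :
  taylor2 h z a0 a1 a2 -> taylor2 g z b0 b1 b2 ->
  taylor2 (fun x => h x * g x)%C z (a0 * b0) (a0 * b1 + a1 * b0) (a0 * b2 + a1 * b1 + a2 * b0).
Proof.
  intros H H'.
  destruct (taylor2_normalize _ _ _ _ _ H) as [K [d [HK [Hd E]]]].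
  destruct (taylor2_normalize _ _ _ _ _ H') as [K' [d' [HK' [Hd' E']]]].
  set (A := Cmod a0 + Cmod a1 + Cmod a2). set (B := Cmod b0 + Cmod b1 + Cmod b2).
  exists (Cmod (a1 * b2 + a2 * b1)%C + Cmod (a2 * b2)%C + A * K' + K * B + K * K'), (Rmin d d').
  split; [now apply Rmin_pos|]. intros u Hu.
  assert (Hu1 : Cmod u < d) by exact (Rlt_le_trans _ _ _ Hu (Rmin_l _ _)).
  assert (Hu2 : Cmod u < d') by exact (Rlt_le_trans _ _ _ Hu (Rmin_r _ _)).
  specialize (E u Hu1). specialize (E' u Hu2).
  assert (HP : Cmod (a0 + a1 * u + a2 * u ^ 2)%C <= A) by (apply Cmod_poly2_le; lra).
  assert (HQ : Cmod (b0 + b1 * u + b2 * u ^ 2)%C <= B) by (apply Cmod_poly2_le; lra).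
  set (P := (a0 + a1 * u + a2 * u ^ 2)%C) in *. set (Q := (b0 + b1 * u + b2 * u ^ 2)%C) in *.
  set (e := (h (z + u) - P)%C) in *. set (e' := (g (z + u) - Q)%C) in *.
  replace (h (z + u) * g (z + u) - (a0 * b0 + (a0 * b1 + a1 * b0) * u + (a0 * b2 + a1 * b1 + a2 * b0) * u ^ 2))%C
    with ((a1 * b2 + a2 * b1) * u ^ 3 + a2 * b2 * u ^ 4 + P * e' + e * Q + e * e')%C
    by (unfold e, e', P, Q; ring).
  pose proof (Cmod_ge_0 u) as Pu.
  set (t := Cmod u ^ 3) in *. assert (Ht : 0 <= t) by now apply pow_le.
  assert (Ht1 : t <= 1) by (unfold t; rewrite <- (pow1 3); apply pow_incr; lra).
  pose proof (Cmod_ge_0 e) as Pe. pose proof (Cmod_ge_0 e') as Pe'.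
  pose proof (Cmod_ge_0 P) as PP. pose proof (Cmod_ge_0 Q) as PQ.
  assert (T1 : Cmod ((a1 * b2 + a2 * b1) * u ^ 3)%C <= Cmod (a1 * b2 + a2 * b1)%C * t)
    by (rewrite Cmod_mult, Cmod_pow; apply Rle_refl).
  assert (T2 : Cmod (a2 * b2 * u ^ 4)%C <= Cmod (a2 * b2)%C * t).
  { rewrite (Cmod_mult (a2 * b2)%C), Cmod_pow. apply Rmult_le_compat_l; [apply Cmod_ge_0|].
    change (Cmod u * t <= t). nra. }
  assert (T3 : Cmod (P * e')%C <= A * K' * t)
    by (rewrite Cmod_mult, Rmult_assoc; now apply Rmult_le_compat).
  assert (T4 : Cmod (e * Q)%C <= K * B * t).
  { rewrite Cmod_mult. replace (K * B * t) with (K * t * B) by ring. now apply Rmult_le_compat. }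
  assert (T5 : Cmod (e * e')%C <= K * K' * t).
  { rewrite Cmod_mult. apply Rle_trans with (K * t * (K' * t)); [now apply Rmult_le_compat|].
    replace (K * t * (K' * t)) with (K * K' * (t * t)) by ring.
    apply Rmult_le_compat_l; [now apply Rmult_le_pos|]. nra. }
  do 4 (eapply Rle_trans; [apply Cmod_triangle|];
        repeat rewrite Rmult_plus_distr_r; apply Rplus_le_compat; [|assumption]).
  exact T1.
Qed.

Lemma taylor2_continuous (h : C -> C) (z c0 c1 c2 : C) (eps : R) :
  taylor2 h z c0 c1 c2 -> 0 < eps ->
  exists d, 0 < d /\ forall u, Cmod u < d -> Cmod (h (z + u) - c0)%C < eps.
Proof.
  intros H Heps.
  destruct (taylor2_normalize _ _ _ _ _ H) as [K [d [HK [Hd E]]]].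
  pose proof (Cmod_ge_0 c1) as P1. pose proof (Cmod_ge_0 c2) as P2.
  set (L := K + Cmod c1 + Cmod c2 + 1).
  assert (HL : 0 < L) by (unfold L; lra).
  exists (Rmin d (eps / L)). split; [apply Rmin_pos; [lra|now apply Rdiv_lt_0_compat]|].
  intros u Hu. pose proof (Cmod_ge_0 u) as Pu.
  assert (Hu1 : Cmod u < d) by exact (Rlt_le_trans _ _ _ Hu (Rmin_l _ _)).
  assert (Hu2 : Cmod u < eps / L) by exact (Rlt_le_trans _ _ _ Hu (Rmin_r _ _)).
  specialize (E u Hu1).
  apply Rle_lt_trans with (L * Cmod u).
  - replace (h (z + u) - c0)%C
      with (h (z + u) - (c0 + c1 * u + c2 * u ^ 2) + u * (c1 + c2 * u + 0 * u ^ 2))%C by ring.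
    eapply Rle_trans; [apply Cmod_triangle|].
    rewrite (Cmod_mult u).
    pose proof (Cmod_poly2_le c1 c2 0 u ltac:(lra)) as B. rewrite Cmod_0 in B.
    assert (Cmod u ^ 3 <= Cmod u) by (assert (Cmod u ^ 2 <= 1) by nra; simpl in *; nra).
    unfold L. nra.
  - apply (Rmult_lt_compat_l L) in Hu2; [|exact HL].
    replace (L * (eps / L)) with eps in Hu2 by (field; lra). exact Hu2.
Qed.

Lemma taylor2_quadratic (h : C -> C) (z c0 c1 c2 : C) :
  taylor2 h z c0 c1 c2 ->
  exists K d, 0 <= K /\ 0 < d /\
    forall u, Cmod u < d -> Cmod (h (z + u) - h z - c1 * u)%C <= K * Cmod u ^ 2.
Proof.
  intro H. rewrite (taylor2_value _ _ _ _ _ H).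
  destruct (taylor2_normalize _ _ _ _ _ H) as [K [d [HK [Hd E]]]].
  exists (K + Cmod c2), d. pose proof (Cmod_ge_0 c2). split; [lra|]. split; [lra|].
  intros u Hu. specialize (E u Hu).
  replace (h (z + u) - c0 - c1 * u)%C
    with (h (z + u) - (c0 + c1 * u + c2 * u ^ 2) + c2 * u ^ 2)%C by ring.
  eapply Rle_trans; [apply Cmod_triangle|]. rewrite Cmod_mult, Cmod_pow.
  pose proof (Cmod_ge_0 u). assert (Cmod u ^ 3 <= Cmod u ^ 2) by (simpl; nra). nra.
Qed.

Lemma taylor2_derive (h : C -> C) (z c0 c1 c2 : C) :
  taylor2 h z c0 c1 c2 -> C_derive h z = c1.
Proof.
  intro H. destruct (taylor2_quadratic _ _ _ _ _ H) as [K [d [HK [Hd E]]]].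
  exact (C_derive_quadratic h z c1 K d Hd E).
Qed.

(** The coefficients b0, b1, b2 invert the 2-jet of h formally, so h times this quadratic polynomial
    Q is 1 + O(|u|^3). Dividing by h, which stays above |c0| / 2 in modulus near z, gives the error
    of 1/h - Q. *)
Lemma taylor2_inv (h : C -> C) (z c0 c1 c2 : C) :
  taylor2 h z c0 c1 c2 -> c0 <> 0 ->
  exists b2, taylor2 (fun x => / h x)%C z (/ c0) (- c1 / c0 ^ 2) b2.
Proof.
  intros H Hc. exists ((c1 ^ 2 - c0 * c2) / c0 ^ 3)%C.
  set (b0 := (/ c0)%C). set (b1 := (- c1 / c0 ^ 2)%C). set (b2 := ((c1 ^ 2 - c0 * c2) / c0 ^ 3)%C).
  assert (HQ : taylor2 (fun x => b0 + b1 * (x - z) + b2 * (x - z) ^ 2)%C z b0 b1 b2).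
  { exists 0, 1. split; [lra|]. intros u _.
    match goal with |- Cmod ?a <= _ => replace a with (RtoC 0) by ring end. rewrite Cmod_0. lra. }
  pose proof (taylor2_mult _ _ _ _ _ _ _ _ _ H HQ) as HM.
  replace (c0 * b0)%C with (RtoC 1) in HM by (unfold b0; now field).
  replace (c0 * b1 + c1 * b0)%C with (RtoC 0) in HM by (unfold b0, b1; now field).
  replace (c0 * b2 + c1 * b1 + c2 * b0)%C with (RtoC 0) in HM by (unfold b0, b1, b2; now field).
  destruct HM as [K [d [Hd E]]].
  assert (Pc : 0 < Cmod c0) by now apply Cmod_gt_0.
  destruct (taylor2_continuous _ _ _ _ _ (Cmod c0 / 2) H ltac:(lra)) as [d' [Hd' E']].
  exists (K * (2 / Cmod c0)), (Rmin d d'). split; [now apply Rmin_pos|]. intros u Hu.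
  specialize (E u (Rlt_le_trans _ _ _ Hu (Rmin_l _ _))).
  specialize (E' u (Rlt_le_trans _ _ _ Hu (Rmin_r _ _))).
  assert (Hh : Cmod c0 / 2 < Cmod (h (z + u)%C)).
  { pose proof (Cmod_triangle (h (z + u)%C) (- (h (z + u) - c0))%C) as T.
    replace (h (z + u) + - (h (z + u) - c0))%C with c0 in T by ring.
    rewrite Cmod_opp in T. lra. }
  assert (Hne : h (z + u)%C <> 0) by (apply Cmod_gt_0; lra).
  replace (z + u - z)%C with u in E by ring.
  set (Q := (b0 + b1 * u + b2 * u ^ 2)%C) in *.
  replace (/ h (z + u) - Q)%C with (- (h (z + u) * Q - (1 + 0 * u + 0 * u ^ 2)) / h (z + u))%C by now field.
  rewrite Cmod_div, Cmod_opp by assumption.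
  set (e := Cmod _) in *.
  assert (He : 0 <= e) by apply Cmod_ge_0.
  replace (K * (2 / Cmod c0) * Cmod u ^ 3) with (K * Cmod u ^ 3 * / (Cmod c0 / 2)) by (field; lra).
  apply Rmult_le_compat; [exact He| |exact E|].
  - apply Rlt_le, Rinv_0_lt_compat. lra.
  - apply Rinv_le_contravar; lra.
Qed.

(** The derivative is given multiplied by z, which avoids the exponent m - 1 at m = 0 and is the
    form in which it enters z q'(z). *)
Lemma taylor2_pow (z : C) (m : nat) :
  exists d1 d2, taylor2 (fun x => x ^ m)%C z (z ^ m)%C d1 d2 /\ (d1 * z = RtoC (INR m) * z ^ m)%C.
Proof.
  induction m as [|m [d1 [d2 [H E]]]].
  - exists 0%R, 0%R. split; [apply (taylor2_const 1%R)|simpl; ring].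
  - do 2 eexists. split.
    + exact (taylor2_mult _ _ _ _ _ _ _ _ _ (taylor2_id z) H).
    + rewrite S_INR, RtoC_plus. simpl.
      transitivity (z * (d1 * z) + z * z ^ m)%C; [ring|]. rewrite E. ring.
Qed.

Definition smooth2 (h : C -> C) (z : C) : Prop := exists c0 c1 c2, taylor2 h z c0 c1 c2.

Lemma smooth2_ext_loc (h g : C -> C) (z : C) (d : R) :
  0 < d -> (forall u, Cmod u < d -> h (z + u)%C = g (z + u)%C) -> smooth2 h z -> smooth2 g z.
Proof.
  intros Hd E [c0 [c1 [c2 H]]]. exists c0, c1, c2. exact (taylor2_ext_loc h g z c0 c1 c2 d Hd E H).
Qed.

Lemma smooth2_const (c z : C) : smooth2 (fun _ => c) z.
Proof. do 3 eexists. apply taylor2_const. Qed.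

Lemma smooth2_pow (z : C) (m : nat) : smooth2 (fun x => x ^ m)%C z.
Proof. destruct (taylor2_pow z m) as [d1 [d2 [H _]]]. do 3 eexists. exact H. Qed.

Lemma smooth2_plus (h g : C -> C) (z : C) :
  smooth2 h z -> smooth2 g z -> smooth2 (fun x => h x + g x)%C z.
Proof.
  intros [a0 [a1 [a2 H]]] [b0 [b1 [b2 H']]]. do 3 eexists. exact (taylor2_plus _ _ _ _ _ _ _ _ _ H H').
Qed.

Lemma smooth2_mult (h g : C -> C) (z : C) :
  smooth2 h z -> smooth2 g z -> smooth2 (fun x => h x * g x)%C z.
Proof.
  intros [a0 [a1 [a2 H]]] [b0 [b1 [b2 H']]]. do 3 eexists. exact (taylor2_mult _ _ _ _ _ _ _ _ _ H H').
Qed.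

Lemma smooth2_inv (h : C -> C) (z : C) :
  smooth2 h z -> h z <> 0 -> smooth2 (fun x => / h x)%C z.
Proof.
  intros [c0 [c1 [c2 H]]] Hz. rewrite (taylor2_value _ _ _ _ _ H) in Hz.
  destruct (taylor2_inv _ _ _ _ _ H Hz) as [b2 H']. do 3 eexists. exact H'.
Qed.

Lemma smooth2_continuous (h : C -> C) (z : C) (eps : R) :
  smooth2 h z -> 0 < eps ->
  exists d, 0 < d /\ forall y, Cmod (y - z)%C < d -> Cmod (h y - h z)%C < eps.
Proof.
  intros [c0 [c1 [c2 H]]] Heps.
  destruct (taylor2_continuous _ _ _ _ _ eps H Heps) as [d [Hd E]].
  exists d. split; [exact Hd|]. intros y Hy.
  rewrite (taylor2_value _ _ _ _ _ H).
  specialize (E _ Hy). now replace (z + (y - z))%C with y in E by ring.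
Qed.

(** * Maximum principle and Jack's lemma *)

(** Every passage to the limit below, in eps or in a radius, takes this form. *)
Lemma Rle_of_small (a b c s0 : R) :
  0 < s0 -> (forall s, 0 < s < s0 -> a <= b + c * s) -> a <= b.
Proof.
  intros Hs H. apply Rnot_lt_le. intro Hab.
  pose proof (Rabs_pos c) as Pc. pose proof (Rle_abs c) as Qc.
  set (s := Rmin (s0 / 2) ((a - b) / (2 * (Rabs c + 1)))).
  assert (Hq : 0 < (a - b) / (2 * (Rabs c + 1))) by (apply Rdiv_lt_0_compat; lra).
  assert (Hs1 : 0 < s) by (apply Rmin_pos; lra).
  assert (Hs2 : s <= s0 / 2) by apply Rmin_l.
  assert (Hs3 : s <= (a - b) / (2 * (Rabs c + 1))) by apply Rmin_r.
  specialize (H s ltac:(lra)).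
  apply (Rmult_le_compat_l (2 * (Rabs c + 1))) in Hs3; [|lra].
  replace (2 * (Rabs c + 1) * ((a - b) / (2 * (Rabs c + 1)))) with (a - b) in Hs3 by (field; lra).
  nra.
Qed.

(** The local bound is tied to the radius as 1/d, so the uniform lower bound on radii that
    compactness of the square provides is at once a uniform bound on phi. *)
Lemma locally_bounded_bounded (S : C -> Prop) (phi : C -> R) (r : R) :
  (forall z, S z -> Cmod z <= r) ->
  (forall z, exists d, 0 < d /\ forall y, S y -> Cmod (y - z)%C < d -> phi y <= / d) ->
  exists M, forall y, S y -> phi y <= M.
Proof.
  intros Hr Hloc.
  (* The gauge has to be a function, hence the choice operator. Radii are halved because closeness
     below d in both coordinates gives [Cmod] below 2 d. *)
  assert (Hch : forall u v : R, {d : posreal | forall y, S y -> Cmod (y - (u, v))%C < 2 * d -> phi y <= / (2 * d)}).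
  { intros u v. apply constructive_indefinite_description.
    destruct (Hloc (u, v)) as [d [Hd H]].
    assert (Hd2 : 0 < d / 2) by lra. exists (mkposreal _ Hd2). simpl.
    replace (2 * (d / 2)) with d by field. exact H. }
  destruct (compactness_value_2d (- r) r (- r) r (fun u v => proj1_sig (Hch u v))) as [d Hd].
  (* [compactness_value_2d] yields its covering point under a double negation, so the goal is first
     turned into [False]. *)
  exists (/ (2 * d)). intros y Hy. apply Rnot_lt_le. intro Hlt.
  pose proof (Rmax_Cmod y) as Hm. specialize (Hr y Hy).
  assert (H1 : Rabs (fst y) <= r) by (eapply Rle_trans; [apply Rmax_l|]; eapply Rle_trans; [exact Hm|exact Hr]).
  assert (H2 : Rabs (snd y) <= r) by (eapply Rle_trans; [apply Rmax_r|]; eapply Rle_trans; [exact Hm|exact Hr]).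
  apply (Hd (fst y) (snd y)); [now apply Rabs_le_between|now apply Rabs_le_between|].
  intros [u [v [_ [_ [Hu [Hv Hduv]]]]]]. destruct (Hch u v) as [e He]. simpl in *.
  assert (Hy2 : Cmod (y - (u, v))%C < 2 * e).
  { eapply Rle_lt_trans; [apply Cmod_2Rmax|].
    assert (Hmax : Rmax (Rabs (fst (y - (u, v))%C)) (Rabs (snd (y - (u, v))%C)) < e)
      by (apply Rmax_lub_lt; assumption).
    assert (Hsq : sqrt 2 <= 2) by (rewrite <- (sqrt_square 2) at 2 by lra; apply sqrt_le_1; lra).
    pose proof Rlt_sqrt2_0. pose proof (cond_pos e).
    pose proof (Rle_trans _ _ _ (Rabs_pos _) (Rmax_l (Rabs (fst (y - (u, v))%C)) (Rabs (snd (y - (u, v))%C)))).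
    nra. }
  specialize (He y Hy Hy2).
  assert (/ (2 * e) <= / (2 * d)) by (apply Rinv_le_contravar; [pose proof (cond_pos d)|]; lra).
  lra.
Qed.

(** An upper semicontinuous function on a compact set. If the supremum M were not attained, 1 / (M -
    phi) would be locally bounded, hence bounded by some B, and M - 1/B would be a smaller upper
    bound. *)
Lemma compact_max (S : C -> Prop) (phi : C -> R) (r : R) :
  (forall z, S z -> Cmod z <= r) ->
  (forall z, ~ S z -> exists d, 0 < d /\ forall y, S y -> ~ Cmod (y - z)%C < d) ->
  (forall z eps, S z -> 0 < eps ->
     exists d, 0 < d /\ forall y, S y -> Cmod (y - z)%C < d -> phi y < phi z + eps) ->
  (exists z, S z) ->
  exists z, S z /\ forall y, S y -> phi y <= phi z.
Proof.
  intros Hr Hcl Hus [z1 Hz1].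
  assert (Hloc : forall psi : C -> R,
    (forall z, S z -> exists e d, 0 < e /\ 0 < d /\ forall y, S y -> Cmod (y - z)%C < d -> psi y <= / e) ->
    exists M, forall y, S y -> psi y <= M).
  { intros psi H. apply (locally_bounded_bounded S psi r Hr). intro z.
    destruct (classic (S z)) as [Hz|Hz].
    - destruct (H z Hz) as [e [d [He [Hd E]]]]. exists (Rmin d e). split; [now apply Rmin_pos|].
      intros y Hy Hyz. eapply Rle_trans.
      + apply (E y Hy). eapply Rlt_le_trans; [exact Hyz|apply Rmin_l].
      + apply Rinv_le_contravar; [now apply Rmin_pos|apply Rmin_r].
    - destruct (Hcl z Hz) as [d [Hd E]]. exists d. split; [exact Hd|].
      intros y Hy Hyz. now destruct (E y Hy). }
  destruct (Hloc phi) as [M0 HM0].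
  { intros z Hz. destruct (Hus z 1 Hz Rlt_0_1) as [d [Hd E]].
    pose proof (Rabs_pos (phi z)). pose proof (Rle_abs (phi z)).
    exists (/ (Rabs (phi z) + 1)), d. split; [apply Rinv_0_lt_compat; lra|]. split; [exact Hd|].
    intros y Hy Hyz. rewrite Rinv_inv. specialize (E y Hy Hyz). lra. }
  destruct (completeness (fun x => exists y, S y /\ x = phi y)) as [M [HM1 HM2]].
  { exists M0. intros x [y [Hy ->]]. now apply HM0. }
  { now exists (phi z1), z1. }
  assert (HM : forall y, S y -> phi y <= M) by (intros y Hy; apply HM1; now exists y).
  apply NNPP. intro Hno.
  assert (Hlt : forall y, S y -> phi y < M).
  { intros y Hy. destruct (HM y Hy) as [|E]; [assumption|]. exfalso. apply Hno.
    exists y. split; [exact Hy|]. rewrite E. exact HM. }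
  destruct (Hloc (fun y => / (M - phi y))) as [B HB].
  { intros z Hz. specialize (Hlt z Hz).
    destruct (Hus z ((M - phi z) / 2) Hz ltac:(lra)) as [d [Hd E]].
    exists ((M - phi z) / 2), d. split; [lra|]. split; [exact Hd|].
    intros y Hy Hyz. specialize (E y Hy Hyz). apply Rinv_le_contravar; lra. }
  assert (HB0 : 0 < B).
  { eapply Rlt_le_trans; [|apply (HB z1 Hz1)]. apply Rinv_0_lt_compat. specialize (Hlt z1 Hz1). lra. }
  assert (Hc : M <= M - / B).
  { apply HM2. intros x [y [Hy ->]]. specialize (HB y Hy). specialize (Hlt y Hy).
    assert (/ B <= M - phi y).
    { rewrite <- (Rinv_inv (M - phi y)). apply Rinv_le_contravar; [apply Rinv_0_lt_compat; lra|exact HB]. }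
    lra. }
  pose proof (Rinv_0_lt_compat B HB0). lra.
Qed.

Lemma closed_disk_closed (r : R) (z : C) :
  ~ Cmod z <= r -> exists d, 0 < d /\ forall y, Cmod y <= r -> ~ Cmod (y - z)%C < d.
Proof.
  intro Hz. apply Rnot_le_lt in Hz. exists (Cmod z - r). split; [lra|].
  intros y Hy Hyz. pose proof (Cmod_triangle y (- (y - z))%C) as T.
  replace (y + - (y - z))%C with z in T by ring. rewrite Cmod_opp in T. lra.
Qed.

Lemma Cmod_add_lower (a b : C) : Cmod a ^ 2 - 2 * Cmod a * Cmod b <= Cmod (a + b)%C ^ 2.
Proof.
  pose proof (Cmod_triangle (a + b) (- b))%C as T.
  replace (a + b + - b)%C with a in T by ring. rewrite Cmod_opp in T.
  pose proof (Cmod_ge_0 a). pose proof (Cmod_ge_0 b). pose proof (Cmod_ge_0 (a + b)%C).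
  destruct (Rle_dec (Cmod a) (Cmod b)); nra.
Qed.

(* Averaging over u, iu, -u, -iu kills the cross terms of a quadratic polynomial, so |h|^2 + eps |z|^2
   cannot have an interior maximum. *)
Lemma no_interior_max (h : C -> C) (z : C) (eps d : R) :
  0 < eps -> 0 < d -> smooth2 h z ->
  ~ forall y, Cmod (y - z)%C < d ->
      Cmod (h y) ^ 2 + eps * Cmod y ^ 2 <= Cmod (h z) ^ 2 + eps * Cmod z ^ 2.
Proof.
  intros Heps Hd [c0 [c1 [c2 H]]] Hmax.
  pose proof (taylor2_value _ _ _ _ _ H) as Hz. rewrite Hz in Hmax.
  destruct (taylor2_normalize _ _ _ _ _ H) as [K [d' [HK [Hd' E]]]].
  set (A := Cmod c0 + Cmod c1 + Cmod c2).
  assert (Hlow : forall u t, Cmod u = t -> 0 < t < Rmin d d' ->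
    Cmod (c0 + c1 * u + c2 * u ^ 2)%C ^ 2 - 2 * A * K * t ^ 3 + eps * Cmod (z + u)%C ^ 2
      <= Cmod c0 ^ 2 + eps * Cmod z ^ 2).
  { intros u t Hu Ht. pose proof (Rmin_l d d'). pose proof (Rmin_r d d').
    specialize (Hmax (z + u)%C). replace (z + u - z)%C with u in Hmax by ring.
    specialize (Hmax ltac:(lra)). specialize (E u ltac:(lra)).
    assert (HP : Cmod (c0 + c1 * u + c2 * u ^ 2)%C <= A) by (apply Cmod_poly2_le; lra).
    set (P := (c0 + c1 * u + c2 * u ^ 2)%C) in *.
    pose proof (Cmod_add_lower P (h (z + u) - P)%C) as L.
    replace (P + (h (z + u) - P))%C with (h (z + u)%C) in L by ring.
    rewrite Hu in E. pose proof (Cmod_ge_0 P). pose proof (Cmod_ge_0 (h (z + u) - P)%C).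
    assert (Cmod P * Cmod (h (z + u) - P)%C <= A * (K * t ^ 3)) by (apply Rmult_le_compat; assumption).
    lra. }
  enough (eps <= 0) by lra.
  apply (Rle_of_small eps 0 (2 * A * K) (Rmin d d')); [apply Rmin_pos; lra|]. intros t Ht.
  assert (Hm : Cmod (RtoC t) = t) by (rewrite Cmod_R; apply Rabs_pos_eq; lra).
  pose proof (Hlow (RtoC t) t Hm Ht) as H1.
  pose proof (Hlow (- RtoC t)%C t ltac:(now rewrite Cmod_opp) Ht) as H2.
  pose proof (Hlow (Ci * RtoC t)%C t ltac:(rewrite Cmod_mult, Cmod_Ci, Hm; ring) Ht) as H3.
  pose proof (Hlow (- (Ci * RtoC t))%C t ltac:(rewrite Cmod_opp, Cmod_mult, Cmod_Ci, Hm; ring) Ht) as H4.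
  rewrite !Cmod2_alt in H1, H2, H3, H4.
  destruct c0 as [a0 b0], c1 as [a1 b1], c2 as [a2 b2], z as [x y].
  simpl in H1, H2, H3, H4.
  (* The average of the four inequalities: |z + u|^2 averages to |z|^2 + t^2, and the squared
     modulus of the quadratic part to at least |c0|^2. *)
  assert (Hsum : t ^ 2 * eps <= t ^ 2 * (0 + 2 * A * K * t)).
  { pose proof (pow2_ge_0 t). pose proof (pow2_ge_0 (a1 * t)). pose proof (pow2_ge_0 (b1 * t)).
    pose proof (pow2_ge_0 (a2 * t ^ 2)). pose proof (pow2_ge_0 (b2 * t ^ 2)). lra. }
  apply Rmult_le_reg_l in Hsum; [exact Hsum|]. apply pow_lt. lra.
Qed.

Lemma smooth2_sqr_usc (h : C -> C) (z : C) (k e : R) :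
  0 <= k -> smooth2 h z -> 0 < e ->
  exists d, 0 < d /\ forall y, Cmod (y - z)%C < d ->
    Cmod (h y) ^ 2 + k * Cmod y ^ 2 < Cmod (h z) ^ 2 + k * Cmod z ^ 2 + e.
Proof.
  intros Hk Hh He.
  assert (Hsq : forall g : C -> C, smooth2 g z -> forall e', 0 < e' ->
    exists d, 0 < d /\ forall y, Cmod (y - z)%C < d -> Cmod (g y) ^ 2 < Cmod (g z) ^ 2 + e').
  { intros g Hg e' He'.
    pose proof (Cmod_ge_0 (g z)) as Pz.
    (* With eta <= 1, (|g z| + eta)^2 exceeds |g z|^2 by at most eta (2 |g z| + 1), which is below
       e'. *)
    set (eta := Rmin 1 (e' / (2 * Cmod (g z) + 2))).
    assert (Hq : 0 < e' / (2 * Cmod (g z) + 2)) by (apply Rdiv_lt_0_compat; lra).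
    assert (Heta : 0 < eta) by (apply Rmin_pos; lra).
    destruct (smooth2_continuous g z eta Hg Heta) as [d [Hd E]].
    exists d. split; [exact Hd|]. intros y Hy. specialize (E y Hy).
    pose proof (Cmod_triangle (g y - g z) (g z))%C as T.
    replace (g y - g z + g z)%C with (g y) in T by ring.
    assert (H1 : eta <= 1) by apply Rmin_l.
    assert (H2 : eta <= e' / (2 * Cmod (g z) + 2)) by apply Rmin_r.
    apply (Rmult_le_compat_l (2 * Cmod (g z) + 2)) in H2; [|lra].
    replace ((2 * Cmod (g z) + 2) * (e' / (2 * Cmod (g z) + 2))) with e' in H2 by (field; lra).
    pose proof (Cmod_ge_0 (g y)).
    assert (Cmod (g y) < Cmod (g z) + eta) by lra. nra. }
  destruct (Hsq h Hh (e / 2) ltac:(lra)) as [d1 [Hd1 E1]].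
  assert (Hid : smooth2 (fun x => x) z) by (do 3 eexists; apply taylor2_id).
  assert (He' : 0 < e / (2 * (k + 1))) by (apply Rdiv_lt_0_compat; lra).
  destruct (Hsq _ Hid _ He') as [d2 [Hd2 E2]].
  exists (Rmin d1 d2). split; [now apply Rmin_pos|]. intros y Hy.
  specialize (E1 y (Rlt_le_trans _ _ _ Hy (Rmin_l _ _))).
  specialize (E2 y (Rlt_le_trans _ _ _ Hy (Rmin_r _ _))).
  assert (k * (e / (2 * (k + 1))) <= e / 2).
  { apply (Rmult_le_reg_r (2 * (k + 1))); [lra|].
    replace (k * (e / (2 * (k + 1))) * (2 * (k + 1))) with (k * e) by (field; lra). lra. }
  assert (k * Cmod y ^ 2 <= k * (Cmod z ^ 2 + e / (2 * (k + 1)))) by (apply Rmult_le_compat_l; lra).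
  lra.
Qed.

(** The perturbed function |h|^2 + eps |z|^2 attains its maximum over the closed disk, necessarily
    on the circle, whence |h z|^2 <= B^2 + eps r^2; then eps tends to 0. *)
Lemma max_modulus_principle (h : C -> C) (r B : R) :
  0 <= r -> 0 <= B ->
  (forall z, Cmod z <= r -> smooth2 h z) ->
  (forall z, Cmod z = r -> Cmod (h z) <= B) ->
  forall z, Cmod z <= r -> Cmod (h z) <= B.
Proof.
  intros Hr HB Hh Hbd z Hz.
  enough (H2 : Cmod (h z) ^ 2 <= B ^ 2).
  { apply Rsqr_incr_0; [unfold Rsqr; simpl in H2; lra|apply Cmod_ge_0|exact HB]. }
  apply (Rle_of_small _ _ (r ^ 2) 1 Rlt_0_1). intros eps [Heps _].
  destruct (compact_max (fun y => Cmod y <= r) (fun y => Cmod (h y) ^ 2 + eps * Cmod y ^ 2) r)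
    as [m [Hm Hmax]].
  - auto.
  - apply closed_disk_closed.
  - intros y e Hy He.
    destruct (smooth2_sqr_usc h y eps e ltac:(lra) (Hh y Hy) He) as [d [Hd E]].
    exists d. split; [exact Hd|]. intros x _. apply E.
  - now exists z.
  - destruct (Rle_lt_or_eq_dec _ _ Hm) as [Hlt|Heq].
    + exfalso. apply (no_interior_max h m eps (r - Cmod m) Heps ltac:(lra) (Hh m Hm)).
      intros y Hy. apply Hmax.
      pose proof (Cmod_triangle (y - m) m)%C as T.
      replace (y - m + m)%C with y in T by ring. lra.
    + specialize (Hmax z Hz). specialize (Hbd m Heq). simpl in Hmax. rewrite Heq in Hmax.
      pose proof (Cmod_ge_0 (h m)). pose proof (Cmod_ge_0 z).
      assert (0 <= eps * Cmod z ^ 2) by (apply Rmult_le_pos; [lra|apply pow2_ge_0]).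
      assert (Cmod (h m) ^ 2 <= B ^ 2) by (apply pow_incr; lra).
      simpl in *. lra.
Qed.

(** * Schwarz' lemma of order n and Jack's lemma *)

Lemma bernoulli (s : R) (n : nat) : 0 <= s <= 1 -> 1 - INR n * s <= (1 - s) ^ n.
Proof.
  intro Hs. induction n as [|n IH]; [simpl; lra|].
  rewrite S_INR. pose proof (pos_INR n). simpl pow.
  apply (Rmult_le_compat_l (1 - s)) in IH; [|lra]. nra.
Qed.

Lemma pow_one_minus_le (s : R) (n : nat) :
  0 <= s <= 1 -> (1 - s) ^ n <= 1 - INR n * s + INR n ^ 2 * s ^ 2.
Proof.
  intro Hs. induction n as [|n IH]; [simpl; lra|].
  rewrite S_INR. pose proof (pos_INR n) as P. simpl pow in *.
  apply (Rmult_le_compat_l (1 - s)) in IH; [|lra].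
  assert (0 <= INR n * INR n * (s * s * s)) by (repeat apply Rmult_le_pos; lra).
  assert (0 <= INR n * (s * s)) by (repeat apply Rmult_le_pos; lra).
  assert (0 <= s * s) by (apply Rmult_le_pos; lra).
  lra.
Qed.

(** On the circle of radius t = (1 - s) r one has |h| <= t^(-n), so the maximum principle gives (1 -
    s)^n X <= 1 for X = r^n |h z|. Bernoulli turns this into X <= 1 + X n s, and s tends to 0. *)
Lemma schwarz_order (h : C -> C) (n : nat) (r : R) :
  0 < r ->
  (forall z, Cmod z < r -> smooth2 h z) ->
  (forall z, Cmod z < r -> Cmod z ^ n * Cmod (h z) <= 1) ->
  forall z, Cmod z < r -> r ^ n * Cmod (h z) <= 1.
Proof.
  intros Hr Hh Hb z Hz.
  set (X := r ^ n * Cmod (h z)).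
  assert (HX : 0 <= X) by (apply Rmult_le_pos; [apply pow_le; lra|apply Cmod_ge_0]).
  apply (Rle_of_small X 1 (X * INR n) ((r - Cmod z) / r)); [apply Rdiv_lt_0_compat; lra|].
  intros s Hs.
  pose proof (Cmod_ge_0 z) as Pz.
  assert (Hsr : s * r < r - Cmod z).
  { destruct Hs as [_ Hs]. apply (Rmult_lt_compat_r r) in Hs; [|exact Hr].
    replace ((r - Cmod z) / r * r) with (r - Cmod z) in Hs by (field; lra). exact Hs. }
  assert (Hs1 : s < 1) by nra.
  set (t := (1 - s) * r).
  assert (Ht : Cmod z < t) by (unfold t; lra).
  assert (Htr : t < r) by (unfold t; nra).
  assert (Ptn : 0 < t ^ n) by (apply pow_lt; lra).
  assert (Hmx : Cmod (h z) <= / t ^ n).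
  { apply (max_modulus_principle h t); [lra|apply Rlt_le, Rinv_0_lt_compat, Ptn| | |lra].
    - intros y Hy. apply Hh. lra.
    - intros y Hy. specialize (Hb y ltac:(lra)). rewrite Hy in Hb.
      apply (Rmult_le_reg_l (t ^ n)); [exact Ptn|]. rewrite Rinv_r by lra. exact Hb. }
  apply (Rmult_le_compat_l (t ^ n)) in Hmx; [|lra]. rewrite Rinv_r in Hmx by lra.
  unfold t in Hmx. rewrite Rpow_mult_distr, Rmult_assoc in Hmx. fold X in Hmx.
  pose proof (bernoulli s n ltac:(lra)) as Hbe.
  apply (Rmult_le_compat_r X) in Hbe; [|exact HX]. lra.
Qed.

(** At (1 - s) z0, Schwarz gives |w| <= (1 - s)^n = 1 - n s + O(s^2), while the expansion at z0
    gives |w| >= 1 - s |d z0| - O(s^2). Dividing by s leaves n <= |d z0| + O(s). *)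
Lemma jack (w h : C -> C) (n : nat) (z0 w0 d b : C) :
  z0 <> 0 ->
  (forall z, Cmod z < Cmod z0 -> smooth2 h z) ->
  (forall z, Cmod z < Cmod z0 -> w z = (z ^ n * h z)%C) ->
  (forall z, Cmod z < Cmod z0 -> Cmod (w z) <= 1) ->
  taylor2 w z0 w0 d b -> Cmod w0 = 1 ->
  INR n <= Cmod (d * z0)%C.
Proof.
  intros Hz0 Hh Hw Hw1 HT Hw0.
  assert (Pz : 0 < Cmod z0) by now apply Cmod_gt_0.
  assert (HS : forall z, Cmod z < Cmod z0 -> Cmod z0 ^ n * Cmod (h z) <= 1).
  { apply schwarz_order; [exact Pz|exact Hh|].
    intros z Hz. specialize (Hw1 z Hz). rewrite (Hw z Hz), Cmod_mult, Cmod_pow in Hw1. exact Hw1. }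
  pose proof (taylor2_value _ _ _ _ _ HT) as Hv.
  destruct (taylor2_quadratic _ _ _ _ _ HT) as [K [e [HK [He E]]]].
  apply (Rle_of_small _ _ (INR n ^ 2 + K * Cmod z0 ^ 2) (Rmin 1 (e / Cmod z0))).
  { apply Rmin_pos; [lra|now apply Rdiv_lt_0_compat]. }
  intros s [Hs Hs'].
  assert (Hs1 : s < 1) by (eapply Rlt_le_trans; [exact Hs'|apply Rmin_l]).
  assert (Hs2 : s * Cmod z0 < e).
  { assert (Hs2 : s < e / Cmod z0) by (eapply Rlt_le_trans; [exact Hs'|apply Rmin_r]).
    apply (Rmult_lt_compat_r (Cmod z0)) in Hs2; [|exact Pz].
    replace (e / Cmod z0 * Cmod z0) with e in Hs2 by (field; lra). exact Hs2. }
  set (u := (- (RtoC s * z0))%C).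
  assert (Hu : Cmod u = s * Cmod z0).
  { unfold u. rewrite Cmod_opp, Cmod_mult, Cmod_R, Rabs_pos_eq by lra. reflexivity. }
  assert (Hzu : Cmod (z0 + u)%C = (1 - s) * Cmod z0).
  { replace (z0 + u)%C with (RtoC (1 - s) * z0)%C by (unfold u; rewrite RtoC_minus; ring).
    rewrite Cmod_mult, Cmod_R, Rabs_pos_eq by lra. reflexivity. }
  assert (Hin : Cmod (z0 + u)%C < Cmod z0) by (rewrite Hzu; nra).
  specialize (E u ltac:(lra)). rewrite Hu in E.
  assert (Hup : Cmod (w (z0 + u)%C) <= (1 - s) ^ n).
  { rewrite (Hw _ Hin), Cmod_mult, Cmod_pow, Hzu, Rpow_mult_distr.
    specialize (HS _ Hin). rewrite Rmult_assoc.
    rewrite <- (Rmult_1_r ((1 - s) ^ n)) at 2. apply Rmult_le_compat_l; [apply pow_le; lra|exact HS]. }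
  pose proof (pow_one_minus_le s n ltac:(lra)) as Hp.
  assert (Hlo : 1 <= Cmod (w (z0 + u)%C) + s * Cmod (d * z0)%C + K * (s * Cmod z0) ^ 2).
  { rewrite <- Hw0, <- Hv.
    replace (w z0) with (w (z0 + u) + (- (d * u) + - (w (z0 + u) - w z0 - d * u)))%C by ring.
    eapply Rle_trans; [apply Cmod_triangle|]. rewrite Rplus_assoc. apply Rplus_le_compat_l.
    eapply Rle_trans; [apply Cmod_triangle|]. rewrite !Cmod_opp. apply Rplus_le_compat; [|exact E].
    rewrite !Cmod_mult, Hu. apply Req_le. ring. }
  apply (Rmult_le_reg_l s); [exact Hs|]. simpl pow in *. lra.
Qed.

(** * The quotient f'(z) / (p z^(p-1)) *)

Lemma smooth2_derive (f : C -> C) (z : C) :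
  analytic_on_disk f -> unit_disk z -> smooth2 (C_derive f) z.
Proof.
  intros Hf Hz. destruct (Hf z Hz) as [a Ha]. apply has_pseries_derive in Ha.
  set (b := fun k => (RtoC (INR (S k)) * a (S k))%C) in Ha.
  destruct (pseries_taylor _ _ _ 2 Ha) as [K [d [Hd H]]].
  exists (b 0%nat), (b 1%nat), (b 2%nat), K, d. split; [exact Hd|].
  intros u Hu. specialize (H u Hu). rewrite !sum_Sn, sum_O in H.
  replace (b 0%nat + b 1%nat * u + b 2%nat * u ^ 2)%C
    with (b 0%nat * u ^ 0 + b 1%nat * u ^ 1 + b 2%nat * u ^ 2)%C by ring.
  exact H.
Qed.

(** With p = m + 1 this is z^(p-2) = z^(p-1) / z; the cases m = 0, m = 1 and m >= 2 are exponents
    -1, 0 and positive. *)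
Lemma Cpowz_pred2 (z : C) (m : nat) :
  z <> 0 -> Cpowz z (Z.of_nat (S m) - 2) = (z ^ m / z)%C.
Proof.
  intro Hz. destruct m as [|[|m]].
  - simpl. now field.
  - simpl. now field.
  - replace (Z.of_nat (S (S (S m))) - 2)%Z with (Z.pos (Pos.of_succ_nat m)) by lia.
    simpl Cpowz. rewrite SuccNat2Pos.id_succ. simpl. now field.
Qed.

Lemma deriv_quot_taylor2 (m : nat) (f : C -> C) (z : C) :
  analytic_on_disk f -> unit_disk z -> z <> 0 ->
  exists q1 q2, taylor2 (deriv_quot (S m) f) z (deriv_quot (S m) f z) q1 q2
    /\ deriv2_quot (S m) f z = (RtoC (INR (S m)) * (q1 * z))%C.
Proof.
  intros Hf Hu Hz.
  destruct (smooth2_derive f z Hf Hu) as [c0 [c1 [c2 Hc]]].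
  destruct (taylor2_pow z m) as [d1 [d2 [Hd Ed]]].
  pose proof (taylor2_mult _ _ _ _ _ _ _ _ _ (taylor2_const (RtoC (INR (S m))) z) Hd) as Hden.
  assert (Hp : RtoC (INR (S m)) <> 0).
  { intro E. apply RtoC_inj in E. now apply (not_0_INR (S m)). }
  assert (Hzm : (z ^ m)%C <> 0) by now apply Cpow_nz.
  assert (Hpz : (RtoC (INR (S m)) * z ^ m)%C <> 0) by now apply Cmult_neq_0.
  destruct (taylor2_inv _ _ _ _ _ Hden Hpz) as [b2 Hinv].
  pose proof (taylor2_mult _ _ _ _ _ _ _ _ _ Hc Hinv) as HT.
  assert (Pz : 0 < Cmod z) by now apply Cmod_gt_0.
  apply (taylor2_ext_loc _ (deriv_quot (S m) f) _ _ _ _ (Cmod z) Pz) in HT.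
  (* For |u| < |z| the point z + u is not 0, so the value assigned at 0 does not interfere. *)
  2:{ intros u Hlt. unfold deriv_quot. destruct (Ceq_dec (z + u)%C (RtoC 0)) as [E|E].
      - exfalso. replace u with (z + u - z)%C in Hlt by ring. rewrite E in Hlt.
        replace (0 - z)%C with (- z)%C in Hlt by ring. rewrite Cmod_opp in Hlt. lra.
      - now replace (S m - 1)%nat with m by lia. }
  rewrite (taylor2_value _ _ _ _ _ HT).
  do 2 eexists. split; [exact HT|].
  unfold deriv2_quot. destruct (Ceq_dec z (RtoC 0)) as [E|_]; [contradiction|].
  rewrite (taylor2_derive _ _ _ _ _ Hc), (taylor2_value _ _ _ _ _ Hc), (Cpowz_pred2 z m Hz).
  replace (S m - 1)%nat with m by lia.
  set (P := RtoC (INR (S m))) in *.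
  assert (EP : (P - 1)%C = RtoC (INR m)) by (unfold P; rewrite S_INR, RtoC_plus; ring).
  rewrite EP.
  (* Here c0 = f'(z) and c1 = f''(z); m z^m is exchanged for d1 z to match the quotient rule. *)
  transitivity (c1 * z / z ^ m - c0 * (RtoC (INR m) * z ^ m) / (z ^ m) ^ 2)%C; [now field|].
  rewrite <- Ed. field. now split.
Qed.

(** For t k = b k u^k, with b the coefficients of f', the term m is p z^(p-1) and the last three
    carry the 2-jet of H at 0. *)
Lemma lacunary_sum (t : nat -> C) (m n : nat) :
  (1 <= n)%nat -> (forall k, (k < m + n)%nat -> k <> m -> t k = 0) ->
  sum_n (G := C_NormedModule) t (m + n + 2)
  = (t m + (t (m + n)%nat + t (m + n + 1)%nat + t (m + n + 2)%nat))%C :> C.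
Proof.
  intros Hn Ht.
  assert (Hs : forall k, (k < m + n)%nat ->
            sum_n (G := C_NormedModule) t k = (if le_dec m k then t m else RtoC 0) :> C).
  { induction k as [|k IH]; intro Hk.
    - rewrite sum_O. destruct (le_dec m 0) as [H|H].
      + now replace m with 0%nat by lia.
      + apply Ht; lia.
    - rewrite sum_Sn, IH by lia.
      change (plus (G := C_NormedModule) ?x ?y) with (x + y)%C.
      destruct (le_dec m k) as [H|H], (le_dec m (S k)) as [H'|H']; try lia.
      + rewrite (Ht (S k)) by lia. ring.
      + replace (S k) with m by lia. ring.
      + rewrite (Ht (S k)) by lia. ring. }
  replace (m + n + 2)%nat with (S (S (S (m + n - 1)))) by lia.
  rewrite !sum_Sn, Hs by lia.
  replace (S (m + n - 1)) with (m + n)%nat by lia.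
  replace (m + n + 1)%nat with (S (m + n)) by lia.
  destruct (le_dec m (m + n - 1)) as [_|H]; [|lia].
  change (t m + t (m + n)%nat + t (S (m + n)) + t (S (S (m + n)))
          = t m + (t (m + n)%nat + t (S (m + n)) + t (S (S (m + n)))))%C. ring.
Qed.

Lemma deriv_quot_expansion (m n : nat) (f : C -> C) :
  (1 <= n)%nat -> class_A (S m) n f ->
  exists H : C -> C, forall z, unit_disk z ->
    smooth2 H z /\ deriv_quot (S m) f z = (1 + z ^ n * H z)%C.
Proof.
  intros Hn [Hf [a [Ha [Hap Ha0]]]].
  apply has_pseries_derive in Ha.
  set (b := fun k => (RtoC (INR (S k)) * a (S k))%C) in Ha.
  set (P := RtoC (INR (S m))).
  assert (Hp : P <> 0).
  { intro E. apply RtoC_inj in E. now apply (not_0_INR (S m)). }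
  assert (PP : 0 < Cmod P) by now apply Cmod_gt_0.
  (* Differentiation shifts indices by one: b m = p, and below m + n all other b k vanish. Dividing
     f' - p z^m by p z^(m+n) leaves the series with coefficients B. *)
  set (B := fun j => (b (m + n + j)%nat / P)%C).
  exists (fun z => if Ceq_dec z (RtoC 0) then B 0%nat else (deriv_quot (S m) f z - 1) / z ^ n)%C.
  intros z Hz. split.
  - destruct (Ceq_dec z (RtoC 0)) as [->|Hz0].
    + exists (B 0%nat), (B 1%nat), (B 2%nat).
      destruct (pseries_taylor _ _ _ (m + n + 2) Ha) as [K [d [Hd E]]].
      exists (Rabs K / Cmod P), d. split; [exact Hd|]. intros u Hu. specialize (E u Hu).
      replace (0 + u)%C with u in * by ring.
      assert (HK : 0 <= Rabs K / Cmod P).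
      { apply Rmult_le_pos; [apply Rabs_pos|now apply Rlt_le, Rinv_0_lt_compat]. }
      destruct (Ceq_dec u (RtoC 0)) as [->|Hu0].
      * replace (B 0%nat - (B 0%nat + B 1%nat * 0 + B 2%nat * 0 ^ 2))%C with (RtoC 0) by ring.
        rewrite Cmod_0. apply Rmult_le_pos; [exact HK|apply pow_le; lra].
      * rewrite lacunary_sum in E; [|exact Hn|].
        2:{ intros k Hk Hkm. unfold b. rewrite Ha0 by lia. ring. }
        assert (Hun : forall k, (u ^ k)%C <> 0) by (intro k; now apply Cpow_nz).
        unfold deriv_quot. destruct (Ceq_dec u (RtoC 0)) as [E0|_]; [contradiction|].
        replace (S m - 1)%nat with m by lia. fold P. unfold B.
        replace (m + n + 0)%nat with (m + n)%nat by lia.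
        assert (Hbm : b m = P) by (unfold b; rewrite Hap; unfold P; ring).
        rewrite Hbm in E.
        match goal with |- Cmod ?x <= _ => set (X := x) end.
        (* The Taylor remainder of f' is O(|u|^(m+n+3)); cancelling p u^(m+n) leaves the cubic error
           for H. *)
        match type of E with Cmod ?y <= _ => replace y with (X * (P * u ^ (m + n)))%C in E end.
        2:{ unfold X. rewrite !Cpow_add_r. simpl. field. repeat split; auto. }
        rewrite !Cmod_mult, Cmod_pow in E.
        assert (Pu : 0 < Cmod u ^ (m + n)) by (apply pow_lt; now apply Cmod_gt_0).
        apply (Rmult_le_reg_r (Cmod P * Cmod u ^ (m + n))); [now apply Rmult_lt_0_compat|].
        eapply Rle_trans; [exact E|].
        replace (S (m + n + 2)) with (3 + (m + n))%nat by lia. rewrite pow_add.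
        replace (Rabs K / Cmod P * Cmod u ^ 3 * (Cmod P * Cmod u ^ (m + n)))
          with (Rabs K * (Cmod u ^ 3 * Cmod u ^ (m + n))) by (field; lra).
        apply Rmult_le_compat_r; [|apply Rle_abs].
        apply Rmult_le_pos; [apply pow_le, Cmod_ge_0|lra].
    + destruct (deriv_quot_taylor2 m f z Hf Hz Hz0) as [q1 [q2 [Hq _]]].
      apply (smooth2_ext_loc (fun x => (deriv_quot (S m) f x + - (1)) * / x ^ n)%C _ z (Cmod z)).
      * now apply Cmod_gt_0.
      * intros u Hlt. destruct (Ceq_dec (z + u)%C (RtoC 0)) as [E|E]; [|reflexivity].
        exfalso. replace u with (z + u - z)%C in Hlt by ring. rewrite E in Hlt.
        replace (0 - z)%C with (- z)%C in Hlt by ring. rewrite Cmod_opp in Hlt. lra.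
      * apply smooth2_mult.
        -- apply (smooth2_plus (deriv_quot (S m) f) (fun _ => (- (1))%C)); [|apply smooth2_const].
           do 3 eexists. exact Hq.
        -- apply (smooth2_inv (fun x => x ^ n)%C); [apply smooth2_pow|now apply Cpow_nz].
  - destruct (Ceq_dec z (RtoC 0)) as [->|Hz0].
    + unfold deriv_quot. destruct (Ceq_dec 0 (RtoC 0)) as [_|E]; [|now contradiction E].
      destruct n as [|n]; [lia|]. simpl. ring.
    + field. now apply Cpow_nz.
Qed.

(** * First point of failure, and the contradiction there *)

Lemma first_exit (v : C -> R) :
  (forall z eps, unit_disk z -> 0 < eps ->
     exists d, 0 < d /\ forall y, Cmod (y - z)%C < d -> Rabs (v y - v z) < eps) ->
  0 < v 0 ->
  (exists z, unit_disk z /\ v z <= 0) ->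
  exists z0, unit_disk z0 /\ z0 <> 0 /\ v z0 = 0 /\ forall z, Cmod z < Cmod z0 -> 0 < v z.
Proof.
  intros Hc H0 [z1 [Hz1 Hv1]]. unfold unit_disk in *.
  (* Least modulus is obtained as the maximum of -|z|; cutting off at |z1| keeps the set inside the
     disk and closed. *)
  destruct (compact_max (fun z => Cmod z <= Cmod z1 /\ v z <= 0) (fun z => - Cmod z) (Cmod z1))
    as [z0 [[Hz0 Hv0] Hmax]].
  - now intros z [Hz _].
  - intros z Hz. destruct (Rle_dec (Cmod z) (Cmod z1)) as [Hle|Hgt].
    + assert (Hvz : 0 < v z) by (apply Rnot_le_lt; intro; apply Hz; now split).
      destruct (Hc z (v z) ltac:(lra) Hvz) as [d [Hd E]]. exists d. split; [exact Hd|].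
      intros y [_ Hy] Hyz. specialize (E y Hyz). apply Rabs_def2 in E. lra.
    + destruct (closed_disk_closed _ _ Hgt) as [d [Hd E]]. exists d. split; [exact Hd|].
      intros y [Hy _]. now apply E.
  - intros z eps _ Heps. exists eps. split; [exact Heps|]. intros y _ Hy.
    pose proof (Cmod_triangle y (- (y - z))%C) as T.
    replace (y + - (y - z))%C with z in T by ring. rewrite Cmod_opp in T. lra.
  - exists z1. split; [apply Rle_refl|exact Hv1].
  - assert (Hne : z0 <> 0) by (intros ->; lra).
    assert (Hpos : forall z, Cmod z < Cmod z0 -> 0 < v z).
    { intros z Hz. apply Rnot_le_lt. intro Hvz.
      specialize (Hmax z ltac:(split; lra)). lra. }
    exists z0. split; [lra|]. split; [exact Hne|]. split; [|exact Hpos].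
    apply Rle_antisym; [exact Hv0|]. apply Rnot_lt_le. intro Hlt.
    (* If v z0 < 0, then v stays negative at (1 - s) z0 for small s, a point of smaller modulus. *)
    destruct (Hc z0 (- v z0) ltac:(lra) ltac:(lra)) as [d [Hd E]].
    assert (P0 : 0 < Cmod z0) by now apply Cmod_gt_0.
    set (s := Rmin (1 / 2) (d / (2 * Cmod z0))).
    assert (Hq : 0 < d / (2 * Cmod z0)) by (apply Rdiv_lt_0_compat; lra).
    assert (Hs : 0 < s) by (apply Rmin_pos; lra).
    assert (Hs1 : s <= 1 / 2) by apply Rmin_l.
    assert (Hs2 : s * Cmod z0 < d).
    { assert (Hs2 : s <= d / (2 * Cmod z0)) by apply Rmin_r.
      apply (Rmult_le_compat_r (Cmod z0)) in Hs2; [|lra].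
      replace (d / (2 * Cmod z0) * Cmod z0) with (d / 2) in Hs2 by (field; lra). lra. }
    set (y := (RtoC (1 - s) * z0)%C).
    assert (Hy1 : Cmod y < Cmod z0).
    { unfold y. rewrite Cmod_mult, Cmod_R, Rabs_pos_eq by lra. nra. }
    assert (Hy2 : Cmod (y - z0)%C < d).
    { replace (y - z0)%C with (- (RtoC s * z0))%C by (unfold y; rewrite RtoC_minus; ring).
      rewrite Cmod_opp, Cmod_mult, Cmod_R, Rabs_pos_eq by lra. exact Hs2. }
    specialize (E y Hy2). specialize (Hpos y Hy1). apply Rabs_def2 in E. lra.
Qed.

Lemma rpow0_pos (x y : R) : 0 < x -> rpow0 x y = Rpower x y.
Proof.
  intro Hx. unfold rpow0. destruct (Req_EM_T y 0) as [->|_].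
  - symmetry. now apply Rpower_O.
  - destruct (Req_EM_T x 0); [lra|reflexivity].
Qed.

(** Turns the lower bounds for the two moduli at z0 into a lower bound for the left-hand side of the
    hypothesis. *)
Lemma rpow0_prod_ge (A B x y beta gamma : R) :
  0 <= beta -> 0 <= gamma -> 0 < A <= x -> 0 < B <= y ->
  Rpower A beta * Rpower B gamma <= rpow0 x beta * rpow0 y gamma.
Proof.
  intros Hb Hg HA HB. rewrite !rpow0_pos by lra.
  apply Rmult_le_compat.
  - apply Rlt_le, exp_pos.
  - apply Rlt_le, exp_pos.
  - apply Rle_Rpower_l; lra.
  - apply Rle_Rpower_l; lra.
Qed.

Theorem theorem2p3 :
  forall (p n : nat) (alpha beta gamma : R) (f : C -> C),
    (1 <= p)%nat -> (1 <= n)%nat ->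
    0 <= alpha < 1 -> 0 <= beta -> 0 <= gamma ->
    class_A p n f ->
    ((forall z : C, unit_disk z ->
        rpow0 (Cmod (deriv_quot p f z - RtoC 1)%C) beta
          * rpow0 (Cmod (deriv2_quot p f z)) gamma
        < Rpower (INR p * INR n) gamma * Rpower (1 - alpha) (beta + gamma)
            / Rpower 2 (beta + 2 * gamma)) ->
     forall z : C, unit_disk z -> Re (deriv_quot p f z) > (1 + alpha) / 2)
    /\
    ((forall z : C, unit_disk z ->
        rpow0 (Cmod (deriv_quot p f z - RtoC 1)%C) beta
          * rpow0 (Cmod (deriv2_quot p f z)) gamma
        < Rpower (INR p * INR n) gamma
            * Rpower (Rabs (1 - alpha)) (beta + gamma)) ->
     forall z : C, unit_disk z -> Cmod (deriv_quot p f z - RtoC 1)%C < 1 - alpha).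
Proof.
  intros p n alpha beta gamma f Hp Hn Hal Hbe Hga HA.
  destruct p as [|m]; [lia|].
  pose proof (proj1 HA) as Hf.
  destruct (deriv_quot_expansion m n f Hn HA) as [H HH].
  assert (Ptay : forall z, unit_disk z -> z <> 0 -> exists q1 q2,
    taylor2 (deriv_quot (S m) f) z (deriv_quot (S m) f z) q1 q2
    /\ deriv2_quot (S m) f z = (RtoC (INR (S m)) * (q1 * z))%C)
    by (intros; now apply deriv_quot_taylor2).
  assert (Hq0 : deriv_quot (S m) f 0 = 1).
  { unfold deriv_quot. destruct (Ceq_dec 0 (RtoC 0)) as [_|E]; [reflexivity|now contradiction E]. }
  set (q := deriv_quot (S m) f) in *.
  (* Through 1 + z^n H, since [Ptay] leaves out the point 0. *)
  assert (Hsm : forall z, unit_disk z -> smooth2 q z).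
  { intros z Hz. apply (smooth2_ext_loc (fun x => 1 + x ^ n * H x)%C q z (1 - Cmod z)).
    - unfold unit_disk in Hz. lra.
    - intros u Hu. symmetry. apply HH. unfold unit_disk.
      eapply Rle_lt_trans; [apply Cmod_triangle|lra].
    - apply (smooth2_plus (fun _ => RtoC 1)); [apply smooth2_const|].
      apply (smooth2_mult (fun x => x ^ n)%C H); [apply smooth2_pow|now apply HH]. }
  assert (Pm : 0 < INR (S m)) by (apply lt_0_INR; lia).
  assert (Pn : 0 < INR n) by (apply lt_0_INR; lia).
  assert (Hcont : forall v : C -> R, (forall y z, Rabs (v y - v z) <= Cmod (q y - q z)%C) ->
    forall z eps, unit_disk z -> 0 < eps ->
      exists d, 0 < d /\ forall y, Cmod (y - z)%C < d -> Rabs (v y - v z) < eps).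
  { intros v Hv z eps Hz Heps.
    destruct (smooth2_continuous q z eps (Hsm z Hz) Heps) as [d [Hd E]].
    exists d. split; [exact Hd|]. intros y Hy. eapply Rle_lt_trans; [apply Hv|]. now apply E. }
  assert (Hpn : forall t z q1, 0 <= t -> INR n * t <= Cmod (q1 * z)%C ->
            deriv2_quot (S m) f z = (RtoC (INR (S m)) * (q1 * z))%C ->
            INR (S m) * INR n * t <= Cmod (deriv2_quot (S m) f z)).
  { intros t z q1 Ht Hle ->. rewrite Cmod_mult, Cmod_R, (Rabs_pos_eq (INR (S m))) by lra.
    rewrite Rmult_assoc. apply Rmult_le_compat_l; lra. }
  split; intros Hyp z Hz.
  - apply Rnot_le_gt. intro Hbad.
    destruct (first_exit (fun y => Re (q y) - (1 + alpha) / 2)) as [z0 [Hz0 [Hne [Hv Hin]]]].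
    + apply Hcont. intros y y'.
      replace (Re (q y) - (1 + alpha) / 2 - (Re (q y') - (1 + alpha) / 2))
        with (Re (q y - q y')%C) by (unfold Cminus; rewrite re_plus, re_opp; ring).
      apply re_le_Cmod.
    + rewrite Hq0. simpl. lra.
    + exists z. split; [exact Hz|]. fold q in Hbad. lra.
    + destruct (Ptay z0 Hz0 Hne) as [q1 [q2 [HT HD]]].
      specialize (Hyp z0 Hz0).
      assert (Hre : forall y, Re (q y - RtoC alpha)%C = Re (q y) - alpha)
        by (intro; unfold Cminus; rewrite re_plus, re_opp, re_RtoC; ring).
      assert (Hnz : forall y, 0 <= Re (q y) - (1 + alpha) / 2 -> (q y - RtoC alpha)%C <> 0).
      { intros y Hy E. specialize (Hre y). rewrite E in Hre. simpl in Hre. lra. }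
      set (rho := Cmod (q z0 - RtoC alpha)%C).
      assert (Hrho : (1 - alpha) / 2 <= rho).
      { pose proof (re_le_Cmod (q z0 - RtoC alpha)%C) as R1. rewrite Hre in R1. fold rho in R1.
        pose proof (Rle_abs (Re (q z0) - alpha)). lra. }
      (* The line Re q = (1 + alpha) / 2 is the perpendicular bisector of alpha and 1; both |w| <= 1
         inside and |w(z0)| = 1 come from this identity. *)
      assert (Hsq : forall y, Cmod (q y - 1)%C ^ 2
                = Cmod (q y - RtoC alpha)%C ^ 2 - 2 * (1 - alpha) * (Re (q y) - (1 + alpha) / 2)).
      { intro y. rewrite !Cmod2_alt. destruct (q y) as [a b]. simpl. field. }
      assert (Hmod : Cmod (q z0 - 1)%C = rho).
      { specialize (Hsq z0). rewrite Hv in Hsq. fold rho in Hsq.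
        pose proof (Cmod_ge_0 (q z0 - 1)%C). simpl in Hsq. nra. }
      assert (Hz0ne : (q z0 - RtoC alpha)%C <> 0) by (apply Hnz; lra).
      (* The jets of 1 - q, of q - alpha and of its inverse combine to that of w = (1 - q) / (q -
         alpha). *)
      pose proof (taylor2_plus _ _ _ _ _ _ _ _ _ (taylor2_const (RtoC 1) z0)
                    (taylor2_mult _ _ _ _ _ _ _ _ _ (taylor2_const (- (1))%C z0) HT)) as T1.
      pose proof (taylor2_plus _ _ _ _ _ _ _ _ _ HT (taylor2_const (- RtoC alpha)%C z0)) as T2.
      destruct (taylor2_inv _ _ _ _ _ T2 Hz0ne) as [b2 T3].
      pose proof (taylor2_mult _ _ _ _ _ _ _ _ _ T1 T3) as TW.
      pose proof (fun h X1 X2 X3 => jack _ h n z0 _ _ _ Hne X1 X2 X3 TW) as J.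
      (* Since 1 - q = - z^n H, this is the cofactor of z^n in w. *)
      specialize (J (fun y => - (1) * H y * / (q y + - RtoC alpha))%C).
      assert (Hj : INR n <= Cmod (q1 * z0)%C * ((1 - alpha) / rho ^ 2)).
      { eapply Rle_trans; [apply J|].
        - intros y Hy. unfold unit_disk in *. apply smooth2_mult.
          + apply (smooth2_mult (fun _ => (- (1))%C) H); [apply smooth2_const|apply HH; unfold unit_disk; lra].
          + apply (smooth2_inv (fun y => q y + - RtoC alpha)%C).
            * apply (smooth2_plus q (fun _ => (- RtoC alpha)%C)); [apply Hsm; unfold unit_disk; lra|apply smooth2_const].
            * apply Hnz. specialize (Hin y Hy). lra.
        - intros y Hy. unfold unit_disk in Hz0.
          assert (Hy1 : unit_disk y) by (unfold unit_disk; lra).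
          pose proof (proj2 (HH y Hy1)) as E. simpl.
          replace (1 + - (1) * q y)%C with (- (y ^ n * H y))%C by (rewrite E; ring). ring.
        - intros y Hy. specialize (Hin y Hy).
          assert (Hny : (q y - RtoC alpha)%C <> 0) by (apply Hnz; lra).
          replace ((1 + - (1) * q y) * / (q y + - RtoC alpha))%C
            with (- (q y - 1) / (q y - RtoC alpha))%C by (now field).
          assert (Py : 0 < Cmod (q y - RtoC alpha)%C) by now apply Cmod_gt_0.
          rewrite Cmod_div, Cmod_opp by exact Hny.
          apply (Rmult_le_reg_r (Cmod (q y - RtoC alpha)%C)); [exact Py|].
          unfold Rdiv. rewrite Rmult_assoc, Rinv_l, Rmult_1_l, Rmult_1_r by lra.
          specialize (Hsq y). pose proof (Cmod_ge_0 (q y - 1)%C). simpl in Hsq.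
          assert (0 <= 2 * (1 - alpha) * (Re (q y) - (1 + alpha) / 2)) by (apply Rmult_le_pos; lra).
          nra.
        - replace ((1 + - (1) * q z0) * / (q z0 + - RtoC alpha))%C
            with (- (q z0 - 1) / (q z0 - RtoC alpha))%C by (now field).
          rewrite Cmod_div, Cmod_opp by exact Hz0ne. rewrite Hmod. fold rho. field. lra.
        - apply Req_le.
          match goal with |- Cmod (?d * z0)%C = _ =>
            replace (d * z0)%C with (- ((q1 * z0) * (RtoC (1 - alpha) / (q z0 - RtoC alpha) ^ 2)))%C
              by (rewrite RtoC_minus; now field) end.
          rewrite Cmod_opp, Cmod_mult, Cmod_div, Cmod_pow, Cmod_R, Rabs_pos_eq by (try lra; now apply Cpow_nz).
          reflexivity. }
      assert (Hq1 : INR n * ((1 - alpha) / 4) <= Cmod (q1 * z0)%C).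
      { assert (Hr2 : (1 - alpha) ^ 2 / 4 <= rho ^ 2) by (simpl; nra).
        apply (Rmult_le_compat_r (rho ^ 2)) in Hj; [|apply pow2_ge_0].
        replace (Cmod (q1 * z0)%C * ((1 - alpha) / rho ^ 2) * rho ^ 2)
          with (Cmod (q1 * z0)%C * (1 - alpha)) in Hj by (field; lra).
        apply (Rmult_le_reg_r (1 - alpha)); [lra|].
        eapply Rle_trans; [|exact Hj].
        replace (INR n * ((1 - alpha) / 4) * (1 - alpha)) with (INR n * ((1 - alpha) ^ 2 / 4)) by field.
        apply Rmult_le_compat_l; lra. }
      pose proof (Hpn ((1 - alpha) / 4) z0 q1 ltac:(lra) Hq1 HD) as Hd2.
      assert (PB : 0 < INR (S m) * INR n * ((1 - alpha) / 4)) by (repeat apply Rmult_lt_0_compat; lra).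
      pose proof (rpow0_prod_ge ((1 - alpha) / 2) _ (Cmod (q z0 - 1)%C) _ beta gamma Hbe Hga
                    ltac:(rewrite Hmod; lra) (conj PB Hd2)) as Hge.
      apply (Rlt_irrefl (rpow0 (Cmod (q z0 - 1)%C) beta * rpow0 (Cmod (deriv2_quot (S m) f z0)) gamma)).
      eapply Rlt_le_trans; [exact Hyp|]. eapply Rle_trans; [|exact Hge]. apply Req_le.
      unfold Rdiv, Rpower. rewrite <- exp_Ropp, <- !exp_plus. f_equal.
      (* Both sides are exponentials of combinations of logarithms; 4 must appear as a product of
         twos to match the 2 gamma in the exponent. *)
      replace (/ 4) with (/ 2 * / 2) by field.
      assert (P1 : 0 < INR (S m) * INR n) by now apply Rmult_lt_0_compat.
      rewrite !ln_mult, !ln_Rinv by (try lra; repeat apply Rmult_lt_0_compat; lra). ring.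
  - apply Rnot_le_lt. intro Hbad.
    destruct (first_exit (fun y => 1 - alpha - Cmod (q y - 1)%C)) as [z0 [Hz0 [Hne [Hv Hin]]]].
    + apply Hcont. intros y y'.
      pose proof (Cmod_triangle (q y - q y') (q y' - 1))%C as A1.
      pose proof (Cmod_triangle (- (q y - q y')) (q y - 1))%C as A2.
      replace (q y - q y' + (q y' - 1))%C with (q y - 1)%C in A1 by ring.
      replace (- (q y - q y') + (q y - 1))%C with (q y' - 1)%C in A2 by ring.
      rewrite Cmod_opp in A2. apply Rabs_le. lra.
    + rewrite Hq0. replace (1 - 1)%C with (RtoC 0) by ring. rewrite Cmod_0. lra.
    + exists z. split; [exact Hz|]. lra.
    + destruct (Ptay z0 Hz0 Hne) as [q1 [q2 [HT HD]]].
      specialize (Hyp z0 Hz0). rewrite Rabs_pos_eq in Hyp by lra.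
      assert (Hal1 : RtoC (1 - alpha) <> 0) by (intro E; apply RtoC_inj in E; lra).
      assert (Hmal : Cmod (RtoC (1 - alpha)) = 1 - alpha) by (rewrite Cmod_R; apply Rabs_pos_eq; lra).
      (* The jet of w = (q - 1) / (1 - alpha), whose cofactor of z^n is H / (1 - alpha). *)
      pose proof (taylor2_mult _ _ _ _ _ _ _ _ _ (taylor2_const (/ RtoC (1 - alpha))%C z0)
                    (taylor2_plus _ _ _ _ _ _ _ _ _ HT (taylor2_const (- (1))%C z0))) as TW.
      pose proof (fun h X1 X2 X3 => jack _ h n z0 _ _ _ Hne X1 X2 X3 TW) as J.
      specialize (J (fun y => / RtoC (1 - alpha) * H y)%C).
      assert (Hmw : forall y, Cmod (/ RtoC (1 - alpha) * (q y + - (1)))%C = Cmod (q y - 1)%C / (1 - alpha)).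
      { intro y. rewrite Cmod_mult, Cmod_inv, Hmal by exact Hal1. apply Rmult_comm. }
      assert (Hq1 : INR n * (1 - alpha) <= Cmod (q1 * z0)%C).
      { apply (Rmult_le_reg_r (/ (1 - alpha))); [apply Rinv_0_lt_compat; lra|].
        rewrite Rmult_assoc, Rinv_r, Rmult_1_r by lra.
        eapply Rle_trans; [apply J|].
        - intros y Hy. unfold unit_disk in Hz0.
          apply (smooth2_mult (fun _ => (/ RtoC (1 - alpha))%C) H);
            [apply smooth2_const|apply HH; unfold unit_disk; lra].
        - intros y Hy. unfold unit_disk in Hz0.
          assert (Hy1 : unit_disk y) by (unfold unit_disk; lra).
          pose proof (proj2 (HH y Hy1)) as E. simpl. rewrite E. ring.
        - intros y Hy. specialize (Hin y Hy). rewrite Hmw.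
          apply (Rmult_le_reg_r (1 - alpha)); [lra|].
          unfold Rdiv. rewrite Rmult_assoc, Rinv_l by lra. lra.
        - rewrite Hmw. replace (Cmod (q z0 - 1)%C) with (1 - alpha) by lra. field. lra.
        - apply Req_le.
          match goal with |- Cmod (?d * z0)%C = _ =>
            replace (d * z0)%C with (q1 * z0 * / RtoC (1 - alpha))%C by now field end.
          now rewrite Cmod_mult, Cmod_inv, Hmal by exact Hal1. }
      pose proof (Hpn (1 - alpha) z0 q1 ltac:(lra) Hq1 HD) as Hd2.
      assert (PB : 0 < INR (S m) * INR n * (1 - alpha)) by (repeat apply Rmult_lt_0_compat; lra).
      pose proof (rpow0_prod_ge (1 - alpha) _ (Cmod (q z0 - 1)%C) _ beta gamma Hbe Hga
                    ltac:(lra) (conj PB Hd2)) as Hge.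
      apply (Rlt_irrefl (rpow0 (Cmod (q z0 - 1)%C) beta * rpow0 (Cmod (deriv2_quot (S m) f z0)) gamma)).
      eapply Rlt_le_trans; [exact Hyp|]. eapply Rle_trans; [|exact Hge]. apply Req_le.
      unfold Rpower. rewrite <- !exp_plus. f_equal.
      assert (P1 : 0 < INR (S m) * INR n) by now apply Rmult_lt_0_compat.
      rewrite (ln_mult (INR (S m) * INR n)) by lra. ring.
Qed.
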